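(* Let $f=\frac1N\sum_{i=1}^N f_i$ with minimizer $x^*$, where each $f_i:\mathbb{R}^d\to\mathbb{R}$ is convex and $L$-smooth and $f$ is $\mu$-strongly convex; let $\kappa=L/\mu$. Consider the DASVRG algorithm (described in the context). Suppose $\sigma=\frac{L}{n}$, $\eta=\frac{1}{16L}$, $T=96\,\kappa(f_\sigma)$ with $\kappa(f_\sigma)=\frac{L+\sigma}{\mu+\sigma}$, $K$ is chosen as $$K=\frac{1}{\log(9/8)}\log\left(\frac{4}{2-\sqrt q}+\frac{10368\,\sigma}{\mu q(1-\frac{\sqrt q}{2})^2}\right),\qquad q=\frac{\mu}{\mu+\sigma},$$ and $TKP=Q\le\tilde n m$, where $P$ is the number of outer iterations. Then DASVRG finds an $\epsilon$-optimal solution of $\min_{x\in\mathbb{R}^d} f(x)$ after $$O\left(\left(1+\sqrt{\frac{\kappa}{n}}\right)\log\left(1+\frac{\kappa}{n}\right)\log(1/\epsilon)\right)$$ calls of the subroutine SS-SVRG.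
   Context: Setting. $N=mn$ with positive integers $m\ll n$; $m$ is the number of machines. Norms are Euclidean. $f_i$ is $L$-smooth if it is differentiable with $\|\nabla f_i(x)-\nabla f_i(y)\|\le L\|x-y\|$ for all $x,y$. The convex function $f=\frac1N\sum_i f_i$ is $\mu$-strongly convex ($\mu>0$): $\|\nabla f(x)-\nabla f(y)\|\ge\mu\|x-y\|$ for all $x,y$. $x^*$ is the unique minimizer of $f$. A random $\hat x$ is $\epsilon$-optimal if $\mathbb{E}[f(\hat x)-f(x^* )]\le\epsilon$. Each machine can store at most $C$ of the functions, with $n<C<N$, and $\tilde n:=C-n\ge cn$ for a universal constant $c>0$. The $O$ notation treats the optimality gap of the initial solution as a constant. For $\sigma\ge0$ and $y\in\mathbb{R}^d$ let $\tilde f_i(x;y)=f_i(x)+\frac\sigma2\|x-y\|^2$ and $f_\sigma(x;y)=f(x)+\frac\sigma2\|x-y\|^2=\frac1N\sum_i\tilde f_i(x;y)$. Gradients of $\tilde f_i(\cdot;y)$ are in the first argument. DASVRG algorithm. Inputs: $\hat x_0\in\mathbb{R}^d$, a step length $\eta<\frac1{4L}$, numbers $T,K,P$ (iterations per stage, stages per outer iteration, outer iterations), $\sigma\ge0$, and a sample size $Q=TKP\le\tilde n m$. (1) Data allocation: produce a random partition $S_1,\dots,S_m$ of $[N]=\{1,\dots,N\}$ with $|S_j|=n$, and indices $r_1,\dots,r_Q$ i.i.d. uniform on $[N]$. With $J=\lceil Q/\tilde n\rceil$, define multi-sets $R_j=\{r_{(j-1)\tilde n+1},\dots,r_{j\tilde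 n}\}$ for $j<J$, $R_J=\{r_{(J-1)\tilde n+1},\dots,r_Q\}$, $R_j=\emptyset$ for $j>J$. Machine $j$ stores $\{f_i:i\in S_j\cup R_j\}$. Set $k\leftarrow1$, $q=\frac{\mu}{\mu+\sigma}$, $y_0=\hat x_0$, $\alpha_0=\sqrt q$. (2) For $p=1,\dots,P$: set $\tilde x^0=\hat x_{p-1}$. For $\ell=0,\dots,K-1$: the machines compute in parallel $h_j^\ell=\sum_{i\in S_j}\nabla\tilde f_i(\tilde x^\ell;y_{p-1})$ and the center forms $h^\ell=\frac1N\sum_{j=1}^m h_j^\ell$ and sends it to machine $k$; then the subroutine SS-SVRG (single-stage SVRG) is called: set $x_0=\tilde x^\ell$, $\bar x_0=\mathbf 0$; for $t=0,\dots,T-1$, machine $k$ samples an element $i$ from $R_k$, sets $$x_{t+1}=x_t-\eta\left(\nabla\tilde f_i(x_t;y_{p-1})-\nabla\tilde f_i(\tilde x^\ell;y_{p-1})+h^\ell\right),\qquad\bar x_{t+1}=\frac{x_{t+1}+t\bar x_t}{t+1},$$ and removes (one copy of) $i$ from $R_k$; if $R_k$ becomes empty, $x_{t+1},\bar x_{t+1}$ are sent to machine $k+1$ and $k\leftarrow k+1$; finally $\tilde x^{\ell+1}=\bar x_T$. After the $K$ stages, set $\hat x_p=\tilde x^K$, compute $\alpha_p\in(0,1)$ from $\alpha_p^2=(1-\alpha_p)\alpha_{p-1}^2+q\alpha_p$, and set $y_p=\hat x_p+\beta_p(\hat x_p-\hat x_{p-1})$ with $\beta_p=\frac{\alpha_{p-1}(1-\alpha_{p-1})}{\alpha_{p-1}^2+\alpha_p}$.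 (3) Output $\hat x_P$.
   Formalization: The factor log(1+κ/n) is replaced by max(δ, log(1+κ/n)) for any fixed δ>0 (the O-constant may depend on δ), since the stated bound tends to 0 as κ/n→0 and fails there; ε≤ε0<1 is assumed, and T and K are rounded up to integers. *)

(* Defs.v *)
From mathcomp Require Export all_boot all_order all_algebra.
From mathcomp Require Export all_classical all_reals all_analysis.

Set Implicit Arguments.
Unset Strict Implicit.
Unset Printing Implicit Defensive.

Export Order.TTheory GRing.Theory Num.Theory.
Export numFieldNormedType.Exports.

Local Open Scope classical_set_scope.
Local Open Scope ring_scope.

(* Finitely supported probability distributions, as lists of weighted outcomes
   (the same outcome may be listed several times).  Every distribution used
   below is obtained from [dret], [dbind] and [dunif] on a nonempty list, hence
   has total mass 1. *)
Definition dist (R : realType) (A : Type) : Type := seq (R * A).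

Definition dret (R : realType) (A : Type) (a : A) : dist R A := [:: (1, a)].

Definition dbind (R : realType) (A B : Type) (D : dist R A) (k : A -> dist R B) :
    dist R B :=
  [seq (p.1 * r.1, r.2) | p <- D, r <- k p.2].

(* Uniform over the positions of [s], i.e. over the multiset listed by [s]. *)
Definition dunif (R : realType) (A : Type) (s : seq A) : dist R A :=
  [seq ((size s)%:R^-1, a) | a <- s].

Definition dexpect (R : realType) (A : Type) (D : dist R A) (g : A -> R) : R :=
  \sum_(p <- D) p.1 * g p.2.

Notation "'draw' x <- D ; E" := (dbind D (fun x => E))
  (at level 200, x name, D at level 100, E at level 200, right associativity).

(* Runs [step 0], ..., [step n.-1] in this order. *)
Fixpoint diter (R : realType) (A : Type) (n : nat) (step : nat -> A -> dist R A)
    (a : A) : dist R A :=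
  if n is n'.+1 then draw b <- diter n' step a; step n' b else dret R a.

(* The norm [`|v|] of the library on row vectors is the sup norm; it induces
   the same notion of differentiability as the Euclidean norm. *)
Definition enorm (R : realType) (d : nat) (v : 'rV[R]_d) : R :=
  Num.sqrt (\sum_(j < d) v 0 j ^+ 2).

Definition grad (R : realType) (d : nat) (g : 'rV[R]_d -> R) (x : 'rV[R]_d) :
    'rV[R]_d :=
  \row_(j < d) 'D_(delta_mx 0 j) g x.

Definition smooth (R : realType) (d : nat) (L : R) (g : 'rV[R]_d -> R) : Prop :=
  (forall x, differentiable g x) /\
  (forall x y, enorm (grad g x - grad g y) <= L * enorm (x - y)).

Definition convex (R : realType) (d : nat) (g : 'rV[R]_d -> R) : Prop :=
  convex_function [set: 'rV[R]_d] g.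

(* For a differentiable convex [g]. *)
Definition strongly_convex (R : realType) (d : nat) (mu : R)
    (g : 'rV[R]_d -> R) : Prop :=
  forall x y, mu * enorm (x - y) <= enorm (grad g x - grad g y).

Definition minimizer (R : realType) (d : nat) (g : 'rV[R]_d -> R)
    (xs : 'rV[R]_d) : Prop :=
  forall x, g xs <= g x.

Definition average (R : realType) (d N : nat) (F : 'I_N -> 'rV[R]_d -> R)
    (x : 'rV[R]_d) : R :=
  N%:R^-1 * \sum_(i < N) F i x.

(* x |-> g x + sigma / 2 * ||x - y||^2 *)
Definition prox (R : realType) (d : nat) (sigma : R) (g : 'rV[R]_d -> R)
    (y x : 'rV[R]_d) : R :=
  g x + sigma / 2 * enorm (x - y) ^+ 2.

Definition eps_optimal (R : realType) (d : nat) (g : 'rV[R]_d -> R)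
    (xs : 'rV[R]_d) (eps : R) (D : dist R 'rV[R]_d) : Prop :=
  dexpect D (fun x => g x - g xs) <= eps.

(* An assignment [a] of the N = m * n functions to the m machines encodes the
   ordered partition S_j = {i | a i = j}; it is admissible if every machine
   receives exactly n functions. *)
Definition part (m n : nat) (a : {ffun 'I_(m * n) -> 'I_m}) (j : 'I_m) :
    {set 'I_(m * n)} :=
  [set i | a i == j]%SET.

Definition balanced (m n : nat) : pred {ffun 'I_(m * n) -> 'I_m} :=
  [pred a | [forall j, #|part a j| == n]].

(* The machine currently in charge together with the multisets R_j of indices
   not yet consumed.  Machines are numbered from 0. *)
Definition pool (N : nat) : Type := (nat * (nat -> seq 'I_N))%type.

(* R_j is the j-th consecutive block of length [nt] of r_1, ..., r_Q: the last
   nonempty block may be shorter, and all later ones are empty. *)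
Definition pool_init (N nt : nat) (r : seq 'I_N) : pool N :=
  (0%N, fun j => take nt (drop (j * nt) r)).

Definition pool_current (N : nat) (w : pool N) : seq 'I_N := w.2 w.1.

Definition pool_remove (N : nat) (w : pool N) (i : 'I_N) : pool N :=
  let Rk := rem i (pool_current w) in
  (if nilp Rk then w.1.+1 else w.1, fun j => if j == w.1 then Rk else w.2 j).

(* One iteration of SS-SVRG on the state (x_t, bar x_t); [G i] is the gradient
   of the i-th component, [xt] the reference point and [h] the full gradient
   there. *)
Definition svrg_step (R : realType) (d N : nat) (eta : R)
    (G : 'I_N -> 'rV[R]_d -> 'rV[R]_d) (xt h : 'rV[R]_d) (t : nat)
    (s : pool N * ('rV[R]_d * 'rV[R]_d)) :
    dist R (pool N * ('rV[R]_d * 'rV[R]_d)) :=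
  let: (w, (x, xbar)) := s in
  draw i <- dunif R (pool_current w);
  let x' := x - eta *: (G i x - G i xt + h) in
  let xbar' := t.+1%:R^-1 *: (x' + t%:R *: xbar) in
  dret R (pool_remove w i, (x', xbar')).

Definition ss_svrg (R : realType) (d N T : nat) (eta : R)
    (G : 'I_N -> 'rV[R]_d -> 'rV[R]_d) (xt h : 'rV[R]_d) (w : pool N) :
    dist R (pool N * 'rV[R]_d) :=
  draw s <- diter T (svrg_step eta G xt h) (w, (xt, 0));
  dret R (s.1, s.2.2).

Definition full_grad (R : realType) (d m n : nat)
    (S : 'I_m -> {set 'I_(m * n)}) (G : 'I_(m * n) -> 'rV[R]_d -> 'rV[R]_d)
    (x : 'rV[R]_d) : 'rV[R]_d :=
  (m * n)%:R^-1 *: \sum_(j < m) \sum_(i in S j) G i x.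

Definition svrg_stage (R : realType) (d m n T : nat) (eta : R)
    (S : 'I_m -> {set 'I_(m * n)}) (G : 'I_(m * n) -> 'rV[R]_d -> 'rV[R]_d)
    (l : nat) (s : pool (m * n) * 'rV[R]_d) :
    dist R (pool (m * n) * 'rV[R]_d) :=
  ss_svrg T eta G s.2 (full_grad S G s.2) s.1.

Definition alpha_rec (R : realType) (q : R) (alpha : nat -> R) : Prop :=
  alpha 0%N = Num.sqrt q /\
  forall p, 0 < alpha p.+1 < 1 /\
    alpha p.+1 ^+ 2 = (1 - alpha p.+1) * alpha p ^+ 2 + q * alpha p.+1.

(* beta_(p+1) *)
Definition betaS (R : realType) (alpha : nat -> R) (p : nat) : R :=
  alpha p * (1 - alpha p) / (alpha p ^+ 2 + alpha p.+1).

(* Outer iteration number p + 1 on the state (hat x_p, y_p). *)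
Definition outer_step (R : realType) (d m n T K : nat) (eta sigma : R)
    (alpha : nat -> R) (F : 'I_(m * n) -> 'rV[R]_d -> R)
    (S : 'I_m -> {set 'I_(m * n)}) (p : nat)
    (s : pool (m * n) * ('rV[R]_d * 'rV[R]_d)) :
    dist R (pool (m * n) * ('rV[R]_d * 'rV[R]_d)) :=
  let: (w, (xh, y)) := s in
  let G i := grad (prox sigma (F i) y) in
  draw s' <- diter K (svrg_stage T eta S G) (w, xh);
  let xh' := s'.2 in
  dret R (s'.1, (xh', xh' + betaS alpha p *: (xh' - xh))).

(* Law of the output of DASVRG; [nt] is the number of extra functions each
   machine can store.  The subroutine [ss_svrg] is called K * P times. *)
Definition dasvrg (R : realType) (d m n nt T K P : nat) (eta sigma : R)
    (alpha : nat -> R) (F : 'I_(m * n) -> 'rV[R]_d -> R) (x0 : 'rV[R]_d) :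
    dist R 'rV[R]_d :=
  draw a <- dunif R (enum (@balanced m n));
  draw r <- dunif R (enum {: (T * K * P).-tuple 'I_(m * n)});
  draw s <- diter P (outer_step T K eta sigma alpha F (part a))
              (pool_init nt r, (x0, x0));
  dret R s.2.1.

Definition stages_needed (R : realType) (mu sigma q : R) : R :=
  (ln (9 / 8))^-1 *
  ln (4 / (2 - Num.sqrt q) +
      10368 * sigma / (mu * q * (1 - Num.sqrt q / 2) ^+ 2)).

(* Main.v *)
(* Every draw from the current block [R_k] of an i.i.d. uniform list, without
   replacement, is uniform and independent of the past, so the output has the
   law of the process in which all indices are drawn i.i.d. uniformly.

   A function with [mu |x - y| <= |grad f x - grad f y|] that is convex and
   smooth satisfies the usual strong convexity inequality.  Hence one SVRG stage
   halves, in expectation, the gap of the proximal objective: the variance of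
   the estimator is at most [4 L'] times the sum of the gaps at the current and
   reference points, and [eta * L'] lies in [[1/16, 1/8]].  So [K] stages shrink
   the gap by [2^-K], which is at most [s^3 / 24] for [s = sqrt q].

   The recursion for [alpha] forces [alpha_p = s], so the outer loop is Nesterov
   acceleration with constant momentum, applied to inexact proximal points.  With
   exact ones, [f x - f xs + mu / 2 * |v - xs|^2], for [v] the momentum point,
   contracts by [1 - s]; the choice of [K] keeps the factor [1 - s / 2] in
   expectation.  So [O(log (1 / eps) / s)] outer iterations suffice, and
   [1 / s <= 1 + sqrt (kappa / n)]. *)
Require Import Defs.
From mathcomp Require Import all_boot all_order all_algebra.
From mathcomp Require Import all_classical all_reals all_analysis.
From mathcomp Require Import ring lra.

Set Implicit Arguments.
Unset Strict Implicit.
Unset Printing Implicit Defensive.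

Local Open Scope ring_scope.

(** * Expectations under finitely supported distributions *)

Section Dist.
Variable R : realType.

Lemma dexpect_ret (A : Type) (a : A) (g : A -> R) : dexpect (dret R a) g = g a.
Proof. by rewrite /dexpect /dret big_seq1 mul1r. Qed.

Lemma dexpect_bind (A B : Type) (D : dist R A) (k : A -> dist R B) (g : B -> R) :
  dexpect (dbind D k) g = dexpect D (fun a => dexpect (k a) g).
Proof.
rewrite /dexpect /dbind big_allpairs_dep; apply: eq_bigr => p _.
by rewrite big_distrr /=; apply: eq_bigr => r _; rewrite mulrA.
Qed.

Lemma dexpect_unif (A : Type) (s : seq A) (g : A -> R) :
  dexpect (dunif R s) g = (size s)%:R^-1 * \sum_(a <- s) g a.
Proof. by rewrite /dexpect /dunif big_map big_distrr. Qed.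

Lemma dexpectD (A : Type) (D : dist R A) (g h : A -> R) :
  dexpect D (fun a => g a + h a) = dexpect D g + dexpect D h.
Proof. by rewrite /dexpect -big_split; apply: eq_bigr => p _; rewrite mulrDr. Qed.

Lemma dexpectZ (A : Type) (D : dist R A) (c : R) (g : A -> R) :
  dexpect D (fun a => c * g a) = c * dexpect D g.
Proof. by rewrite /dexpect big_distrr; apply: eq_bigr => p _; rewrite mulrCA. Qed.

Lemma eq_dexpect (A : Type) (D : dist R A) (g h : A -> R) :
  g =1 h -> dexpect D g = dexpect D h.
Proof. by move=> gh; apply: eq_bigr => p _; rewrite gh. Qed.

(** A [dist] is a bare list of weighted outcomes, so positivity and mass 1 are required of its
    expectation functional; monotonicity follows. *)
Definition stochastic (A : Type) (D : dist R A) : Prop :=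
  (forall g, (forall a, 0 <= g a) -> 0 <= dexpect D g) /\
  dexpect D (fun=> 1) = 1.

Lemma stochastic_le (A : Type) (D : dist R A) (g h : A -> R) : stochastic D ->
  (forall a, g a <= h a) -> dexpect D g <= dexpect D h.
Proof.
move=> [D0 _] gh; rewrite -subr_ge0 -mulN1r -dexpectZ -dexpectD.
by apply: D0 => a; rewrite mulN1r subr_ge0.
Qed.

Lemma stochastic_cst (A : Type) (D : dist R A) (c : R) : stochastic D ->
  dexpect D (fun=> c) = c.
Proof.
move=> [_ D1]; rewrite -[RHS]mulr1 -[in RHS]D1 -dexpectZ.
by apply: eq_dexpect => a; rewrite mulr1.
Qed.

Lemma stochastic_ret (A : Type) (a : A) : stochastic (dret R a).
Proof. by split=> [g g0|]; rewrite dexpect_ret. Qed.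

Lemma stochastic_bind (A B : Type) (D : dist R A) (k : A -> dist R B) :
  stochastic D -> (forall a, stochastic (k a)) -> stochastic (dbind D k).
Proof.
move=> [D0 D1] pk; split=> [g g0|]; rewrite dexpect_bind.
  by apply: D0 => a; apply: (pk a).1.
by rewrite -[RHS]D1; apply: eq_dexpect => a; apply: (pk a).2.
Qed.

Lemma stochastic_unif (A : Type) (s : seq A) : (0 < size s)%N -> stochastic (dunif R s).
Proof.
move=> s0; split=> [g g0|]; rewrite dexpect_unif.
  by rewrite mulr_ge0 ?invr_ge0 ?ler0n// sumr_ge0.
by rewrite big_const_seq count_predT iter_addr_0 mulVf// pnatr_eq0 -lt0n.
Qed.

Lemma stochastic_iter (A : Type) n (step : nat -> A -> dist R A) a :
  (forall t b, stochastic (step t b)) -> stochastic (diter n step a).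
Proof.
move=> ps; elim: n => [|n IH] /=; first exact: stochastic_ret.
exact: stochastic_bind.
Qed.

End Dist.

(** * Drawing without replacement from i.i.d. uniform indices *)

Section Sampling.
Variables (R : realType) (N : nat).
Hypothesis N_gt0 : (0 < N)%N.

Local Notation I := 'I_N.
Local Notation iunif := (dunif R (enum 'I_N)).

Lemma dexpect_iunif (g : I -> R) : dexpect iunif g = N%:R^-1 * \sum_i g i.
Proof. by rewrite dexpect_unif size_enum_ord big_enum. Qed.

Lemma stochastic_iunif : stochastic iunif.
Proof. by apply: stochastic_unif; rewrite size_enum_ord. Qed.

(** Expectation over an i.i.d. uniform list of length [n], one draw at a time to suit induction. *)
Fixpoint avg (n : nat) (g : seq I -> R) : R :=
  if n is n'.+1 then dexpect iunif (fun i => avg n' (fun s => g (i :: s)))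
  else g [::].

Lemma eq_avg n (g h : seq I -> R) :
  (forall s, size s = n -> g s = h s) -> avg n g = avg n h.
Proof.
elim: n g h => [|n IH] g h gh /=; first exact: gh.
by apply: eq_dexpect => i; apply: IH => s sn; apply: gh; rewrite /= sn.
Qed.

Lemma avgD n (g h : seq I -> R) :
  avg n (fun s => g s + h s) = avg n g + avg n h.
Proof.
elim: n g h => [//|n IH] g h /=; rewrite -dexpectD.
by apply: eq_dexpect => i; rewrite IH.
Qed.

Lemma avgZ n c (g : seq I -> R) : avg n (fun s => c * g s) = c * avg n g.
Proof.
elim: n g => [//|n IH] g /=; rewrite -dexpectZ.
by apply: eq_dexpect => i; rewrite IH.
Qed.

Lemma avg_cst n c : avg n (fun=> c) = c.
Proof.
by elim: n => [//|n IH] /=; rewrite IH stochastic_cst//; exact: stochastic_iunif.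
Qed.

Lemma avg_cat a b (g : seq I -> R) :
  avg (a + b) g = avg a (fun s => avg b (fun r => g (s ++ r))).
Proof.
by elim: a g => [//|a IH] g; rewrite addSn /=; apply: eq_dexpect => i; rewrite IH.
Qed.

(** A prefix of an i.i.d. list is independent of the rest; [minn] covers a last block shorter than
    [k]. *)
Lemma avg_take_drop k c (g : seq I -> seq I -> R) :
  avg c (fun r => g (take k r) (drop k r)) =
  avg (minn k c) (fun s => avg (c - minn k c) (g s)).
Proof.
rewrite -[in LHS](subnKC (geq_minr k c)) avg_cat.
apply: eq_avg => s sn; apply: eq_avg => r rn.
case: (leqP k c) sn => [kc sn|ck sn].
  by rewrite take_size_cat// drop_size_cat.
have /size0nil -> : size r = 0%N by rewrite rn (minn_idPr (ltnW ck)) subnn.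
by rewrite cats0 take_oversize ?drop_oversize// sn ltnW.
Qed.

Lemma avg_exch n (A : Type) (D : dist R A) (g : A -> seq I -> R) :
  avg n (fun s => dexpect D (fun a => g a s)) = dexpect D (fun a => avg n (g a)).
Proof.
rewrite /dexpect; elim: D => [|p D IH].
  rewrite big_nil -[RHS](avg_cst n); apply: eq_avg => s _; exact: big_nil.
rewrite big_cons -IH -avgZ -avgD.
by apply: eq_avg => s _; rewrite big_cons.
Qed.

Lemma dexpect_exch (A B : Type) (D : dist R A) (E : dist R B) (g : A -> B -> R) :
  dexpect D (fun a => dexpect E (g a)) = dexpect E (fun b => dexpect D (g ^~ b)).
Proof.
rewrite /dexpect.
under eq_bigr do rewrite big_distrr /=.
rewrite exchange_big /=; apply: eq_bigr => q _.
by rewrite big_distrr /=; apply: eq_bigr => p _; rewrite mulrCA.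
Qed.

Lemma avg_tuple n (g : seq I -> R) :
  dexpect (dunif R (enum {: n.-tuple I})) (fun r => g r) = avg n g.
Proof.
rewrite dexpect_unif -cardT card_tuple card_ord big_enum /=.
elim: n g => [|n IH] g.
  rewrite expn0 invr1 mul1r (big_pred1 [tuple])// => t.
  by rewrite tuple0; apply/esym/eqP.
rewrite [RHS]/= dexpect_iunif.
under [in RHS]eq_bigr do rewrite -IH.
rewrite -big_distrr /= expnS natrM invfM mulrA; congr (_ * _).
rewrite pair_big /=.
rewrite (reindex (fun p : I * n.-tuple I => [tuple of p.1 :: p.2])) /=.
  by apply: eq_bigr => -[].
exists (fun t : n.+1.-tuple I => (thead t, [tuple of behead t])) => [[i t] _|t _] /=.
  by congr pair; apply: val_inj.
by rewrite -tuple_eta.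
Qed.

(* Removing a uniformly chosen entry from a uniform list leaves, up to
   permutation, a uniform list independent of the removed value. *)
Lemma avg_rem n (Psi : I -> seq I -> R) :
  (forall i s s', perm_eq s s' -> Psi i s = Psi i s') ->
  avg n (fun s => \sum_(i <- s) Psi i (rem i s)) =
  n%:R * dexpect iunif (fun i => avg n.-1 (Psi i)).
Proof.
elim: n Psi => [|n IH] Psi Pinv; first by rewrite /= big_nil mul0r.
have step (j : I) : avg n (fun s => \sum_(i <- j :: s) Psi i (rem i (j :: s))) =
    avg n (Psi j) + n%:R * dexpect iunif (fun i => avg n.-1 (fun s => Psi i (j :: s))).
  rewrite -IH; last by move=> i s s' ss'; apply: Pinv; rewrite perm_cons.
  rewrite -avgD; apply: eq_avg => s _.
  rewrite big_cons /= eqxx; congr (_ + _); rewrite !big_seq; apply: eq_bigr => i si.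
  (* If [i] equals the head [j], [rem] deletes the head instead of the later copy; the results agree
     up to order. *)
  apply: Pinv; case: eqP => [->|//]; exact: perm_to_rem.
rewrite [LHS]/=.
under eq_dexpect do rewrite step.
rewrite dexpectD dexpectZ dexpect_exch -[in RHS]addn1 natrD mulrDl mul1r addrC /=.
by rewrite addn1; case: n {IH step} => [|n] //; rewrite !mul0r.
Qed.


(** [rem] deletes the first copy of a value, whichever position was drawn, so pools are compared
    blockwise up to order. *)
Definition pool_perm (w w' : pool N) : Prop :=
  w.1 = w'.1 /\ forall j, perm_eq (w.2 j) (w'.2 j).

Definition perm_inv (g : pool N -> R) : Prop :=
  forall w w', pool_perm w w' -> g w = g w'.

Lemma pool_perm_remove w w' i :
  pool_perm w w' -> pool_perm (pool_remove w i) (pool_remove w' i).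
Proof.
case: w w' => [k f] [_ f'] [/= <- ff'].
have pr : perm_eq (rem i (f k)) (rem i (f' k)).
  have /seq.permP pc := ff' k.
  by apply/seq.permP => P; rewrite !count_rem pc (perm_mem (ff' k)).
split=> [|j] /=; rewrite /pool_current /=.
  by rewrite /nilp (perm_size pr).
by case: (j == k).
Qed.

Lemma perm_inv_draw (Phi : I -> pool N -> R) : (forall i, perm_inv (Phi i)) ->
  perm_inv (fun w => dexpect (dunif R (pool_current w))
                             (fun i => Phi i (pool_remove w i))).
Proof.
move=> Pinv w w' ww'; have := ww'.2 w.1; rewrite {2}ww'.1 => pc.
rewrite !dexpect_unif (perm_size pc) (perm_big _ pc); congr (_ * _).
by apply: eq_bigr => i _; apply: Pinv; apply: pool_perm_remove.
Qed.


(* [Lam t] is the expectation functional of a random pool from which [t]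
   indices have already been drawn. *)
Definition stock (Q : nat) (Lam : nat -> (pool N -> R) -> R) : Prop :=
  (forall c, Lam Q (fun=> c) = c) /\
  forall t (Phi : I -> pool N -> R), (t < Q)%N -> (forall i, perm_inv (Phi i)) ->
    Lam t (fun w => dexpect (dunif R (pool_current w))
                            (fun i => Phi i (pool_remove w i))) =
    dexpect iunif (fun i => Lam t.+1 (Phi i)).

(** * Replacing draws from the pool by independent draws *)

Section Simulation.
Variables (Q : nat) (Lam : nat -> (pool N -> R) -> R).
Hypothesis LamP : stock Q Lam.

(* [Kp], which consumes [s] indices of the pool, has the law of [Ki].  Test
   functions only see the blocks of the pool up to permutation. *)
Definition sim (s : nat) (A B : Type) (Kp : pool N * A -> dist R (pool N * B))
    (Ki : A -> dist R B) : Prop :=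
  forall (g : pool N -> B -> R) a, (forall b, perm_inv (g^~ b)) ->
  perm_inv (fun w => dexpect (Kp (w, a)) (fun p => g p.1 p.2)) /\
  forall t, (t + s <= Q)%N ->
    Lam t (fun w => dexpect (Kp (w, a)) (fun p => g p.1 p.2)) =
    dexpect (Ki a) (fun b => Lam (t + s) (g^~ b)).

Lemma sim_draw (A B : Type) (upd : A -> I -> B) :
  sim 1 (fun p => dbind (dunif R (pool_current p.1))
                        (fun i => dret R (pool_remove p.1 i, upd p.2 i)))
        (fun a => dbind iunif (fun i => dret R (upd a i))).
Proof.
move=> g a ginv.
rewrite (_ : (fun _ => _) = (fun w => dexpect (dunif R (pool_current w))
    (fun i => g (pool_remove w i) (upd a i)))); last first.
  apply: funext => w; rewrite dexpect_bind; apply: eq_dexpect => i.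
  by rewrite dexpect_ret.
split=> [|t tQ]; first exact: (perm_inv_draw (Phi := fun i w => g w (upd a i))).
rewrite addn1 in tQ *; rewrite dexpect_bind.
rewrite (LamP.2 t (fun i w => g w (upd a i)))//.
by apply: eq_dexpect => i; rewrite dexpect_ret.
Qed.

Lemma sim_ret (A B : Type) (h : A -> B) :
  sim 0 (fun p => dret R (p.1, h p.2)) (fun a => dret R (h a)).
Proof.
move=> g a ginv.
rewrite (_ : (fun _ => _) = (fun w => g w (h a))); last first.
  by apply: funext => w; rewrite dexpect_ret.
by split=> [|t _]; rewrite ?dexpect_ret ?addn0//; exact: ginv.
Qed.

(** The expectation under the second kernel is the test function given to the first; the invariance
    half of [sim] makes it admissible. *)
Lemma sim_bind s s' (A B C : Type) (Kp : pool N * A -> dist R (pool N * B))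
    (Ki : A -> dist R B) (Kp' : A -> pool N * B -> dist R (pool N * C))
    (Ki' : A -> B -> dist R C) :
  sim s Kp Ki -> (forall a, sim s' (Kp' a) (Ki' a)) ->
  sim (s + s') (fun p => dbind (Kp p) (Kp' p.2)) (fun a => dbind (Ki a) (Ki' a)).
Proof.
move=> S S' g a ginv.
pose h w b := dexpect (Kp' a (w, b)) (fun p => g p.1 p.2).
have hinv b : perm_inv (h^~ b) := (S' a g b ginv).1.
rewrite (_ : (fun _ => _) = (fun w => dexpect (Kp (w, a)) (fun p => h p.1 p.2)));
  last first.
  apply: funext => w; rewrite dexpect_bind; apply: eq_dexpect => -[w' b].
  by [].
have [? SE] := S h a hinv; split=> // t; rewrite addnA => tQ.
rewrite SE ?(leq_trans _ tQ) ?leq_addr// dexpect_bind; apply: eq_dexpect => b.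
exact: (S' a g b ginv).2.
Qed.

Lemma sim_map s (A B C : Type) (h : A -> B -> C)
    (Kp : pool N * A -> dist R (pool N * B)) (Ki : A -> dist R B) :
  sim s Kp Ki ->
  sim s (fun p => dbind (Kp p) (fun p' => dret R (p'.1, h p.2 p'.2)))
        (fun a => dbind (Ki a) (fun b => dret R (h a b))).
Proof.
move=> S; rewrite -[s]addn0; exact: (sim_bind (Kp' := fun a p' => dret R (p'.1, h a p'.2))
  (Ki' := fun a b => dret R (h a b)) S (fun a => sim_ret (h a))).
Qed.

(** Lets a kernel depend on the state: the reference point of a stage and the centre of the proximal
    term are parts of it. *)
Lemma sim_comp s (A B C : Type) (h : A -> B)
    (Kp : A -> pool N * B -> dist R (pool N * C)) (Ki : A -> B -> dist R C) :
  (forall a, sim s (Kp a) (Ki a)) ->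
  sim s (fun p => Kp p.2 (p.1, h p.2)) (fun a => Ki a (h a)).
Proof. by move=> S g a ginv; exact: (S a g (h a) ginv). Qed.

Lemma sim_iter s (A : Type) n (Kp : nat -> pool N * A -> dist R (pool N * A))
    (Ki : nat -> A -> dist R A) :
  (forall t, sim s (Kp t) (Ki t)) -> sim (n * s) (diter n Kp) (diter n Ki).
Proof.
move=> S; elim: n => [|n IH] /=.
  by have := sim_ret (@id A); congr sim; apply: funext => -[].
rewrite mulSnr; exact: (sim_bind (Kp' := fun=> Kp n) (Ki' := fun=> Ki n) IH).
Qed.

End Simulation.

(** * The law of the pool, block by block *)

Section Blocks.
Variable nt : nat.
Hypothesis nt_gt0 : (0 < nt)%N.

(** Machine [k] is in charge with [s] left in its block; [r] concatenates the untouched blocks, so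
    that of machine [k.+1] starts at offset 0. *)
Let blocks k (s r : seq I) : pool N :=
  (k, fun j => if (j < k)%N then [::] else if j == k then s
               else take nt (drop ((j - k.+1) * nt) r)).

Let law k b c (Phi : pool N -> R) :=
  avg b (fun s => avg c (fun r => Phi (blocks k s r))).

Let next b k s r := if b is 0%N then blocks k.+1 (take nt r) (drop nt r)
                    else blocks k s r.

Lemma pool_remove_blocks b k (s r : seq I) i : size s = b.+1 -> i \in s ->
  pool_perm (pool_remove (blocks k s r) i) (next b k (rem i s) r).
Proof.
move=> sb si; rewrite /pool_remove /pool_current /= ltnn eqxx.
have: size (rem i s) = b by rewrite size_rem// sb.
case: b sb => [|b] sb /= rb; rewrite /nilp rb /=; last first.
  by split=> //= j; case: (ltngtP j k).
split=> //= j; case: (ltngtP j k) => jk.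
- by rewrite (ltn_trans jk).
- rewrite ltnNge jk /=; case: (j =P k.+1) => [->|/eqP jk1].
    by rewrite subnn mul0n drop0.
  by rewrite drop_drop -mulSnr subnSK// ltn_neqAle jk andbT eq_sym.
- rewrite jk ltnSn; by move/size0nil: rb => ->.
Qed.

Lemma law_next b k c (Phi : pool N -> R) :
  avg b (fun s => avg c (fun r => Phi (next b k s r))) =
  (if b is 0%N then law k.+1 (minn nt c) (c - minn nt c) else law k b c) Phi.
Proof.
by case: b => [|//]; exact: (avg_take_drop nt c (fun s r => Phi (blocks k.+1 s r))).
Qed.

(** This is [avg_rem] for the current block; its factor [b.+1] cancels the weight of a uniform
    draw. *)
Lemma law_draw b k c (Phi : I -> pool N -> R) : (forall i, perm_inv (Phi i)) ->
  law k b.+1 c (fun w => dexpect (dunif R (pool_current w))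
                            (fun i => Phi i (pool_remove w i))) =
  dexpect iunif (fun i => avg b (fun s => avg c (fun r => Phi i (next b k s r)))).
Proof.
move=> Pinv; rewrite /law.
pose Psi i s := avg c (fun r => Phi i (next b k s r)).
transitivity (b.+1%:R^-1 * avg b.+1 (fun s => \sum_(i <- s) Psi i (rem i s))).
  rewrite -avgZ; apply: eq_avg => s sb.
  transitivity (avg c (fun r => dexpect (dunif R s)
      (fun i => Phi i (pool_remove (blocks k s r) i)))).
    by apply: eq_avg => r _; rewrite /pool_current /= ltnn eqxx.
  rewrite avg_exch dexpect_unif sb; congr (_ * _); rewrite !big_seq.
  apply: eq_bigr => i si; apply: eq_avg => r _; apply: Pinv.
  exact: pool_remove_blocks.
rewrite avg_rem ?mulrA ?mulVf ?mul1r ?pnatr_eq0// => i s s' ss'.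
apply: eq_avg => r _; apply: Pinv; rewrite /next; case: (b) => [//|_].
by split=> //= j; case: (ltngtP j k).
Qed.

(** Induction on the number of indices left. The second condition keeps the current block nonempty
    until everything is consumed. *)
Lemma law_stock n k b c : (b + c)%N = n -> (b = 0 -> c = 0)%N ->
  exists2 Lam, stock n Lam & Lam 0%N = law k b c.
Proof.
elim: n k b c => [|n IH] k b c.
  move=> /eqP; rewrite addn_eq0 => /andP[/eqP -> /eqP ->] _.
  by exists (fun=> law k 0 0) => //; split.
case: b => [|b]; first by rewrite add0n => -> /(_ erefl).
rewrite addSn => -[bcn] _.
have [Lam sLam eLam] : exists2 Lam, stock n Lam & Lam 0%N =
    if b is 0%N then law k.+1 (minn nt c) (c - minn nt c) else law k b c.
  case: b bcn => [|b] bcn; apply: IH => //.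
  - by rewrite subnKC ?geq_minr.
  - by rewrite /minn; case: ltnP => [_ e|_ ->//]; move: nt_gt0; rewrite e.
(* After the first draw, the functionals are those given by induction, shifted by one. *)
exists (fun t => if t is t'.+1 then Lam t' else law k b.+1 c) => //.
split=> [|[|t] Phi tn Pinv]; first exact: sLam.1.
  rewrite law_draw//; apply: eq_dexpect => i.
  by rewrite law_next eLam.
exact: sLam.2.
Qed.

Lemma pool_stock Q : exists2 Lam, stock Q Lam &
  forall Phi, perm_inv Phi -> Lam 0%N Phi = avg Q (fun r => Phi (pool_init nt r)).
Proof.
have [||Lam sLam eLam] := @law_stock Q 0 (minn nt Q) (Q - minn nt Q).
- by rewrite subnKC ?geq_minr.
- by rewrite /minn; case: ltnP => [_ e|_ ->//]; move: nt_gt0; rewrite e.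
exists Lam => // Phi Pinv; rewrite eLam.
rewrite /law -(avg_take_drop nt Q (fun s r => Phi (blocks 0 s r))).
apply: eq_avg => r _; apply: Pinv; split=> //= j.
case: (j =P 0%N) => [->|/eqP j0]; first by rewrite mul0n drop0.
by rewrite drop_drop -mulSnr subn1 prednK ?lt0n.
Qed.

End Blocks.

End Sampling.

(** * The Euclidean inner product *)

Section Euclid.
Variables (R : realType) (d : nat).
Implicit Types (u v w x y z : 'rV[R]_d).

Definition dot u v : R := \sum_j u 0 j * v 0 j.

Lemma dotC u v : dot u v = dot v u.
Proof. by apply: eq_bigr => j _; rewrite mulrC. Qed.

Lemma dotDl u v w : dot (u + v) w = dot u w + dot v w.
Proof. by rewrite -big_split; apply: eq_bigr => j _; rewrite mxE mulrDl. Qed.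

Lemma dotZl a u w : dot (a *: u) w = a * dot u w.
Proof. by rewrite /dot big_distrr /=; apply: eq_bigr => j _; rewrite mxE mulrA. Qed.

Lemma dotNl u w : dot (- u) w = - dot u w.
Proof. by rewrite -scaleN1r dotZl mulN1r. Qed.

Lemma dotDr u v w : dot w (u + v) = dot w u + dot w v.
Proof. by rewrite dotC dotDl !(dotC w). Qed.

Lemma dotZr a u w : dot w (a *: u) = a * dot w u.
Proof. by rewrite dotC dotZl (dotC w). Qed.

Lemma dotNr u w : dot w (- u) = - dot w u.
Proof. by rewrite dotC dotNl (dotC w). Qed.

Lemma dot0l w : dot 0 w = 0.
Proof. by rewrite -(scale0r 0) dotZl mul0r. Qed.

Lemma dot0r w : dot w 0 = 0.
Proof. by rewrite dotC dot0l. Qed.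

Lemma dot_suml (I : Type) (r : seq I) (P : pred I) (V : I -> 'rV[R]_d) w :
  dot (\sum_(i <- r | P i) V i) w = \sum_(i <- r | P i) dot (V i) w.
Proof.
by elim/big_rec2: _ => [|i a v _ <-]; rewrite ?dot0l ?dotDl.
Qed.

Definition dotE := (dotDl, dotDr, dotZl, dotZr, dotNl, dotNr).

Lemma dotxx_ge0 u : 0 <= dot u u.
Proof. by apply: sumr_ge0 => j _; rewrite -expr2 sqr_ge0. Qed.

Lemma enorm_ge0 u : 0 <= enorm u.
Proof. exact: sqrtr_ge0. Qed.

Lemma enorm_sqr u : enorm u ^+ 2 = dot u u.
Proof.
have e : dot u u = \sum_(j < d) u 0 j ^+ 2 by apply: eq_bigr => j _; rewrite expr2.
by rewrite sqr_sqrtr -e// dotxx_ge0.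
Qed.

Lemma enorm_eq0 u : enorm u = 0 -> u = 0.
Proof.
move=> u0; apply/rowP => j; rewrite mxE; apply/eqP.
have : dot u u = 0 by rewrite -enorm_sqr u0 expr0n.
move/eqP; rewrite psumr_eq0 => [/allP/(_ j)|i _]; last by rewrite -expr2 sqr_ge0.
by rewrite mem_index_enum -expr2 sqrf_eq0 => /(_ erefl).
Qed.

Lemma cauchy_schwarz u v : dot u v <= enorm u * enorm v.
Proof.
have [u0|u0] := eqVneq (enorm u) 0; first by rewrite (enorm_eq0 u0) dot0l mulr_ge0 ?enorm_ge0.
have [v0|v0] := eqVneq (enorm v) 0; first by rewrite (enorm_eq0 v0) dot0r mulr_ge0 ?enorm_ge0.
have ab : 0 < enorm u * enorm v by rewrite mulr_gt0// lt_def ?u0 ?v0 enorm_ge0.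
rewrite -(ler_pM2l ab) -subr_ge0.
have := dotxx_ge0 (enorm v *: u - enorm u *: v).
by rewrite !dotE -!enorm_sqr (dotC v u); nra.
Qed.

Lemma enormZ a u : 0 <= a -> enorm (a *: u) = a * enorm u.
Proof.
move=> a0; rewrite /enorm.
under eq_bigr do rewrite mxE exprMn.
by rewrite -mulr_sumr sqrtrM ?sqr_ge0// sqrtr_sqr ger0_norm.
Qed.

End Euclid.

(** * Gradients and first-order inequalities *)

Section Gradient.
Local Open Scope classical_set_scope.
Local Open Scope ring_scope.
Variables (R : realType) (d : nat).
Implicit Types (u v w x y z : 'rV[R]_d) (g : 'rV[R]_d -> R).

Lemma grad_dot g x v : differentiable g x -> 'D_v g x = dot (grad g x) v.
Proof.
move=> dg; rewrite deriveE// {1}(row_sum_delta v) linear_sum /=.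
by apply: eq_bigr => j _; rewrite linearZ /= !mxE deriveE// mulrC.
Qed.

(** Stated for an arbitrary field [G], this and [smooth_grad] pass to proximal terms and averages
    without differentiating again. *)
Definition convex_grad g (G : 'rV[R]_d -> 'rV[R]_d) :=
  forall x u, g x + dot (G x) (u - x) <= g u.

Definition smooth_grad (L : R) g (G : 'rV[R]_d -> 'rV[R]_d) :=
  forall x u, g u <= g x + dot (G x) (u - x) + L / 2 * dot (u - x) (u - x).


Lemma is_derive_line g x v (t : R) : differentiable g (x + t *: v) ->
  is_derive t 1 (fun s : R => g (x + s *: v) : R) (dot (grad g (x + t *: v)) v).
Proof.
move=> dg.
have e (h : R) : (h *: (1 : R) + t) *: v = h *: v + t *: v.
  by rewrite scalerDl -[h *: 1]/(h * 1) mulr1.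
have E : (fun h : R => h^-1 *: ((g (x + (h *: (1:R) + t) *: v) : R) - g (x + t *: v))) =
    (fun h => h^-1 *: ((g (h *: v + (x + t *: v)) : R) - g (x + t *: v))).
  by apply: funext => h; rewrite e addrCA.
apply: DeriveDef; rewrite ?/derivable ?/derive E; first exact: diff_derivable.
by rewrite -grad_dot.
Qed.

(** Convexity bounds the difference quotient along the segment by [g u - g x]; the step then tends
    to 0 from the right. *)
Lemma convex_gradP g : (forall x, differentiable g x) -> convex g ->
  convex_grad g (grad g).
Proof.
move=> dg cg x u; rewrite -lerBrDl -grad_dot//.
have /cvg_dnbhs_at_right cvgD : h^-1 *: ((g (h *: (u - x) + x) : R) - g x)
    @[h --> 0^'] --> 'D_(u - x) g x by apply: diff_derivable.
apply: cvgr_to_le cvgD _.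
near=> t.
have t0 : 0 < t by near: t; exact: nbhs_right_gt.
have t1 : t <= 1 by near: t; apply: nbhs_right_le.
have : g (t *: u + (1 - t) *: x) <= t * g u + (1 - t) * g x :=
  cg (Itv01 (ltW t0) t1) u x (in_setT _) (in_setT _).
rewrite (_ : t *: u + _ = t *: (u - x) + x); last first.
  by rewrite scalerBl scale1r scalerBr addrA addrAC.
by rewrite -[t^-1 *: _]/(_ * _) ler_pdivrMl//; lra.
Unshelve. all: by end_near.
Qed.

Lemma smooth_gradP (L : R) g : smooth L g -> smooth_grad L g (grad g).
Proof.
move=> [dg Lg] x u.
have [v ->] : exists v, u = v + x by exists (u - x); rewrite subrK.
rewrite addrK.
(* [g] on the segment minus its quadratic upper model. Cauchy-Schwarz and the Lipschitz bound make
   it nonincreasing; the claim compares [psi 1] with [psi 0]. *)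
pose psi (t : R) : R := g (x + t *: v) - (t * dot (grad g x) v + L / 2 * dot v v * t ^+ 2).
have dpsi (t : R) : is_derive t (1 : R) psi
    (dot (grad g (x + t *: v)) v - (dot (grad g x) v + L / 2 * dot v v * (2 * t))).
  have H1 := @is_derive_line g x v t (dg _).
  apply: is_deriveB.
  apply: is_derive_eq.
  by rewrite /GRing.scale /=; ring.
have d0 (t : R) : t \in `]0, 1[%R -> derive1 psi t <= 0.
  rewrite in_itv /= => /andP[t0 _]; rewrite derive1E derive_val subr_le0.
  have := cauchy_schwarz (grad g (x + t *: v) - grad g x) v.
  have := ler_wpM2r (enorm_ge0 v) (Lg (x + t *: v) x).
  have -> : x + t *: v - x = t *: v by rewrite addrAC subrr add0r.
  rewrite (enormZ _ (ltW t0)) !dotE -enorm_sqr expr2. lra.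
have dp (t : R) : t \in `]0, 1[%R -> derivable psi t 1 by [].
have cp : {within `[0, 1], continuous psi}.
  by apply: derivable_within_continuous.
have := ler0_derive1_le_cc dp d0 cp (x := 1) (y := 0).
rewrite !in_itv /= !lexx !ler01 => /(_ isT isT isT).
rewrite /psi scale1r scale0r addr0 mul1r mul0r expr1n expr0n mulr0 mulr1 !addr0.
by rewrite subr0 (addrC x); lra.
Qed.

Lemma is_derive_sqnorm (sigma : R) y x v :
  is_derive x v (fun x => sigma / 2 * enorm (x - y) ^+ 2 : R) (sigma * dot (x - y) v).
Proof.
(* For [h != 0] the difference quotient is exactly [a + h * b]. *)
pose a := sigma * dot (x - y) v; pose b := sigma / 2 * dot v v.
have E : (fun h : R => h^-1 *: ((sigma / 2 * enorm (h *: v + x - y) ^+ 2 : R)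
            - sigma / 2 * enorm (x - y) ^+ 2)) @ 0^' --> a.
  have : (fun h : R => a + h * b) @ 0^' --> a + 0 * b.
    apply: cvg_within_filter.
    apply: (@cvgD _ R^o); first exact: cvg_cst.
    by apply: (@cvgMr_tmp R); exact: cvg_id.
  rewrite mul0r addr0; apply: cvg_trans; apply: near_eq_cvg.
  near=> h.
  have h0 : h != 0 by near: h; exact: nbhs_dnbhs_neq.
  rewrite -addrA !enorm_sqr -[h^-1 *: _]/(_ * _) /a /b.
  by rewrite !dotE (dotC v x) (dotC v y) (dotC y x); field.
apply: DeriveDef; first by apply/cvg_ex; exists a.
exact: cvg_lim E.
Unshelve. all: by end_near.
Qed.

Lemma grad_prox (sigma : R) g y x : differentiable g x ->
  grad (prox sigma g y) x = grad g x + sigma *: (x - y).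
Proof.
move=> dg; apply/rowP => j; rewrite !mxE.
have dgj : is_derive x (delta_mx 0 j) g ('D_(delta_mx 0 j) g x).
  by apply: derivableP; exact: diff_derivable.
have dq := is_derive_sqnorm sigma y x (delta_mx 0 j).
rewrite (_ : prox sigma g y = g + (fun x => sigma / 2 * enorm (x - y) ^+ 2))//.
rewrite derive_val; congr (_ + _ * _); rewrite /dot (bigD1 j)//= !mxE !eqxx mulr1.
by rewrite big1 ?addr0// => k kj; rewrite !mxE (negbTE kj) andbF mulr0.
Qed.

Lemma average_fun N (F : 'I_N -> 'rV[R]_d -> R) :
  average F = N%:R^-1 *: \sum_(i < N) F i.
Proof. by apply: funext => x; rewrite /average fctE fct_sumE. Qed.

Lemma differentiable_average N (F : 'I_N -> 'rV[R]_d -> R) x :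
  (forall i, differentiable (F i) x) -> differentiable (average F) x.
Proof.
move=> dF; rewrite average_fun; apply: differentiableZ.
exact: differentiable_sum.
Qed.

Lemma grad_average N (F : 'I_N -> 'rV[R]_d -> R) x :
  (forall i, differentiable (F i) x) ->
  grad (average F) x = N%:R^-1 *: \sum_(i < N) grad (F i) x.
Proof.
move=> dF; apply/rowP => j; rewrite !mxE average_fun summxE.
have dFj i : derivable (F i) x (delta_mx 0 j) by exact: diff_derivable.
rewrite deriveZ ?derive_sum//; last exact: derivable_sum.
by congr (_ * _); apply: eq_bigr => i _; rewrite mxE.
Qed.

End Gradient.

(** * Strong convexity, gradient differences and existence of proximal points *)

Section ConvexAnalysis.
Local Open Scope classical_set_scope.
Local Open Scope ring_scope.
Variables (R : realType) (d : nat).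
Implicit Types (u v w x y z : 'rV[R]_d) (g f : 'rV[R]_d -> R).
Implicit Types (G : 'rV[R]_d -> 'rV[R]_d).

(* Fix [x], subtract from [f] its tangent at [x] and run gradient descent on the
   result [phi] with a small step [h].  The hypothesis on the gradients makes
   [phi - c * mu / 2 * |. - x|^2] decrease along the orbit, with [c] close to 1,
   while [phi] itself would drop by a fixed amount at each step if this
   difference were ever negative. *)
Lemma strong_convexity (mu L : R) f G : 0 < mu -> 0 < L ->
  convex_grad f G -> smooth_grad L f G ->
  (forall x y, mu * enorm (x - y) <= enorm (G x - G y)) ->
  forall x u, f x + dot (G x) (u - x) + mu / 2 * dot (u - x) (u - x) <= f u.
Proof.
move=> mu0 L0 cf sf scf x u.
pose phi z := f z - f x - dot (G x) (z - x).
have phi0 z : 0 <= phi z by have := cf x z; rewrite /phi; lra.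
pose sq v := dot v v.
pose D z := sq (z - x).
have GD z : mu ^+ 2 * D z <= sq (G z - G x).
  rewrite /D /sq -!enorm_sqr -exprMn ler_sqr ?nnegrE ?enorm_ge0//.
  by rewrite mulr_ge0 ?enorm_ge0// ltW.
suff main (h : R) : 0 < h -> h * L < 2 -> (1 - L * h / 2) * (mu / 2 * D u) <= phi u.
  suff : mu / 2 * D u <= phi u by rewrite /phi /D /sq; lra.
  rewrite leNgt; apply/negP => lt.
  have M0 : 0 < mu / 2 * D u by apply: le_lt_trans lt.
  (* This [h] makes the left side of [main] the midpoint of [phi u] and [mu / 2 * D u], hence larger
     than [phi u]. *)
  pose h := (mu / 2 * D u - phi u) / (mu / 2 * D u * L).
  have h0 : 0 < h by rewrite divr_gt0 ?subr_gt0 ?(mulr_gt0 M0).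
  have hE : h * L * (mu / 2 * D u) = mu / 2 * D u - phi u.
    by rewrite /h; field; rewrite ?gt_eqF//; move: M0; rewrite pmulr_rgt0 ?divr_gt0.
  have hL : h * L < 2.
    rewrite -(ltr_pM2r M0) hE; have := phi0 u; lra.
  have := main h h0 hL; lra.
move=> h0 hL; set c := 1 - L * h / 2.
have c0 : 0 < c by rewrite /c; lra.
pose step z := z - h *: (G z - G x).
have phi_step z : phi (step z) <= phi z - h * c * sq (G z - G x).
  have := sf z (step z); rewrite /phi /step /sq /c.
  rewrite (addrAC z) subrr add0r !dotE (dotC (G x) (G z)). lra.
have D_step z : mu / 2 * (D z - D (step z)) <= h * sq (G z - G x).
  have cs := cauchy_schwarz (G z - G x) (z - x).
  have s := scf z x.
  have e0 := enorm_ge0 (G z - G x).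
  have E : D (step z) = D z - 2 * h * dot (G z - G x) (z - x) + h ^+ 2 * sq (G z - G x).
    rewrite /D /sq /step (addrAC z) !(dotDl, dotNl, dotZl) !(dotDr, dotNr, dotZr).
    by rewrite (dotC x z) (dotC (G x) (G z)) !(dotC _ (G z)) !(dotC _ (G x)); ring.
  have h1 : mu * dot (G z - G x) (z - x) <= sq (G z - G x).
    rewrite /sq -enorm_sqr expr2; apply: le_trans (ler_wpM2l e0 s).
    by rewrite mulrCA ler_pM2l.
  have h2 := ler_wpM2l (ltW h0) h1.
  have h3 : 0 <= mu / 2 * (h ^+ 2 * sq (G z - G x)).
    by rewrite !mulr_ge0 ?sqr_ge0 ?dotxx_ge0 ?invr_ge0 ?ltW.
  by rewrite E; lra.
rewrite leNgt; apply/negP => lt.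
pose a := c * (mu / 2 * D u) - phi u.
have a0 : 0 < a by rewrite subr_gt0.
pose b := h * mu * a.
have b0 : 0 < b by rewrite !mulr_gt0.
have iter k z : a <= c * (mu / 2 * D z) - phi z -> k%:R * b <= phi z.
  elim: k z => [|k IH] z az; first by rewrite mul0r.
  have S1 := phi_step z; have S2 := ler_wpM2l (ltW c0) (D_step z).
  have /IH S3 : a <= c * (mu / 2 * D (step z)) - phi (step z) by lra.
  have S4 : b <= h * c * sq (G z - G x).
    apply: (@le_trans _ _ (h * c * (mu ^+ 2 * D z))); last first.
      by rewrite ler_pM2l ?mulr_gt0.
    have : h * mu * a <= h * mu * (c * (mu / 2 * D z)).
      rewrite ler_pM2l ?mulr_gt0//; have := phi0 z; lra.
    have : 0 <= h * mu * (c * (mu / 2 * D z)).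
      by rewrite !mulr_ge0 ?dotxx_ge0 ?invr_ge0 ?ltW.
    rewrite /b; lra.
  by rewrite -natr1 mulrDl mul1r; lra.
have [k kP] : exists k, phi u / b < k%:R.
  by exists (Num.truncn (phi u / b)).+1; exact: truncnS_gt.
have := iter k u (lexx _); rewrite leNgt => /negP; apply.
by rewrite -ltr_pdivrMr.
Qed.

Lemma smooth_grad_step (L : R) g G x e : 0 < L -> smooth_grad L g G ->
  g (x - L^-1 *: e) <= g x - L^-1 * dot (G x) e + L^-1 / 2 * dot e e.
Proof.
move=> L0 sg; apply: le_trans (sg x _) _.
have -> : x - L^-1 *: e - x = - (L^-1 *: e) by rewrite addrAC subrr add0r.
rewrite !(dotNl, dotNr, dotZl, dotZr) opprK.
have -> : L / 2 * (L^-1 * (L^-1 * dot e e)) = L^-1 / 2 * dot e e.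
  by field; rewrite gt_eqF.
by [].
Qed.

(** Two bounds are compared at [x - L^-1 *: e]: smoothness at [x] from above, convexity at [w] from
    below. *)
Lemma grad_diff_sqr (L : R) g G : 0 < L -> convex_grad g G -> smooth_grad L g G ->
  forall x w, dot (G x - G w) (G x - G w) <= 2 * L * (g x - g w - dot (G w) (x - w)).
Proof.
move=> L0 cg sg x w; set e := G x - G w.
have H1 := smooth_grad_step x e L0 sg; have H2 := cg w (x - L^-1 *: e).
have H3 : dot (G x) e = dot e e + dot (G w) e by rewrite -dotDl /e subrK.
have H4 : dot (G w) (x - L^-1 *: e - w) = dot (G w) (x - w) - L^-1 * dot (G w) e.
  by rewrite (addrAC x) (dotDr (x - w)) dotNr dotZr.
have H5 : L^-1 / 2 * dot e e <= g x - g w - dot (G w) (x - w).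
  by rewrite H3 in H1; rewrite H4 in H2; lra.
have := ler_wpM2l (ltW L0) H5.
have -> : L * (L^-1 / 2 * dot e e) = dot e e / 2 by field; rewrite gt_eqF.
lra.
Qed.

(** A gradient step of length [L^-1] from [z] would otherwise lower [g]. *)
Lemma minimizer_grad0 (L : R) g G z : 0 < L -> smooth_grad L g G ->
  minimizer g z -> G z = 0.
Proof.
move=> L0 sg mz; apply: enorm_eq0; apply/eqP; rewrite -sqrf_eq0 enorm_sqr.
rewrite eq_le dotxx_ge0 andbT.
have Li : 0 < L^-1 by rewrite invr_gt0.
have H := le_trans (mz _) (smooth_grad_step z (G z) L0 sg).
by rewrite -(ler_pM2l Li); lra.
Qed.

(** The extreme value theorem gives a minimizer on a cube around [y]; outside it the quadratic term
    outweighs the largest possible gain [f y - f xs]. *)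
Lemma prox_min_exists (sigma : R) f xs y : 0 < sigma ->
  (forall x, differentiable f x) -> minimizer f xs ->
  exists z, minimizer (prox sigma f y) z.
Proof.
move=> s0 df mf.
(* As [1 <= M], outside the cube the squared distance to [y] is at least [M ^+ 2 >= M], and
   [sigma / 2 * M] exceeds [f y - f xs]. *)
pose M := 1 + 2 * (f y - f xs) / sigma.
have M1 : 1 <= M.
  by rewrite lerDl divr_ge0 ?mulr_ge0 ?subr_ge0// ltW.
pose A := [set v : 'rV[R]_d | forall i, `[y 0 i - M, y 0 i + M]%classic (v ord0 i)].
have cA : compact A.
  apply: (@rV_compact R d (fun i => `[y 0 i - M, y 0 i + M]%classic)) => i.
  exact: segment_compact.
have Ay : A y by move=> i /=; rewrite in_itv /=; apply/andP; split; lra.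
have cf : continuous f by move=> x; exact: (differentiable_continuous (df x)).
have cq : continuous (fun x => \sum_j (x 0 j - y 0 j) ^+ 2).
  apply: continuous_big => [|j _ x]; first exact: add_continuous.
  have cj : (x0 0 j - y 0 j) @[x0 --> x] --> x 0 j - y 0 j.
    by apply: cvgB; [exact: coord_continuous|exact: cvg_cst].
  exact: (cvgM cj cj).
have phiE x : prox sigma f y x = f x + sigma / 2 * \sum_j (x 0 j - y 0 j) ^+ 2.
  rewrite /prox enorm_sqr; congr (_ + _ * _).
  by apply: eq_bigr => j _; rewrite !mxE expr2.
have cphi : continuous (prox sigma f y).
  rewrite (funext phiE) => x; apply: (cvgD (cf x)).
  by apply: cvgMl_tmp; exact: cq.
have [z Az zmin] := EVT_min_rV (ex_intro _ y Ay) cA (continuous_subspaceT cphi).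
exists z => x; have [/asboolP Ax|] := pselect (A x).
  by apply: zmin; rewrite inE; apply/asboolP.
move=> /existsNP[i /=] /negP; rewrite in_itv /= => iM.
apply: le_trans (zmin y _) _; first by rewrite inE.
have : (x 0 i - y 0 i) ^+ 2 <= \sum_j (x 0 j - y 0 j) ^+ 2.
  by rewrite (bigD1 i)//= lerDl sumr_ge0// => j _; exact: sqr_ge0.
have xM : M <= (x 0 i - y 0 i) ^+ 2.
  apply: (@le_trans _ _ (M ^+ 2)); first by rewrite expr2; nra.
  move: iM; rewrite negb_and -!ltNge => /orP[] ?; nra.
have sM : sigma / 2 * M = sigma / 2 + (f y - f xs).
  by rewrite /M; field; rewrite gt_eqF.
move=> /(le_trans xM); rewrite -(ler_pM2l (divr_gt0 s0 (ltr0n _ 2))) sM => H.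
rewrite !phiE (eq_bigr (fun=> 0)) => [|j _]; last by rewrite subrr expr0n.
by rewrite big1// mulr0 addr0; have := mf x; lra.
Qed.

End ConvexAnalysis.

(** * First-order inequalities for proximal terms and averages *)

Section Closure.
Variables (R : realType) (d : nat).
Implicit Types (u v w x y z : 'rV[R]_d) (g f : 'rV[R]_d -> R).
Implicit Types (G : 'rV[R]_d -> 'rV[R]_d).

(** The exact expansion of the quadratic at [x] reduces inequalities for [prox] to those for [g]. *)
Lemma prox_expand (sigma : R) g y x u :
  prox sigma g y u = g u - g x + prox sigma g y x + dot (sigma *: (x - y)) (u - x)
    + sigma / 2 * dot (u - x) (u - x).
Proof.
rewrite /prox !enorm_sqr !dotE (dotC x u) (dotC y u) (dotC y x).
by field.
Qed.

Lemma convex_grad_prox (sigma : R) g G y : 0 <= sigma -> convex_grad g G ->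
  convex_grad (prox sigma g y) (fun x => G x + sigma *: (x - y)).
Proof.
move=> s0 cg x u; rewrite (prox_expand _ _ _ x u) (dotDl (G x)).
have := cg x u; have := mulr_ge0 s0 (dotxx_ge0 (u - x)); lra.
Qed.

Lemma smooth_grad_prox (sigma L : R) g G y : smooth_grad L g G ->
  smooth_grad (L + sigma) (prox sigma g y) (fun x => G x + sigma *: (x - y)).
Proof.
move=> sg x u; rewrite (prox_expand _ _ _ x u) (dotDl (G x)).
have := sg x u; lra.
Qed.

Variable N : nat.
Hypothesis N_gt0 : (0 < N)%N.

Lemma dot_mean (v : 'I_N -> 'rV[R]_d) u :
  dot (N%:R^-1 *: \sum_i v i) u = N%:R^-1 * \sum_i dot (v i) u.
Proof. by rewrite dotZl dot_suml. Qed.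

Lemma mean_cst (a : R) : N%:R^-1 * \sum_(i < N) a = a.
Proof.
by rewrite sumr_const card_ord -[a *+ N]mulr_natl mulKf// pnatr_eq0 -lt0n.
Qed.

Lemma convex_grad_average (g : 'I_N -> 'rV[R]_d -> R)
    (G : 'I_N -> 'rV[R]_d -> 'rV[R]_d) :
  (forall i, convex_grad (g i) (G i)) ->
  convex_grad (average g) (fun x => N%:R^-1 *: \sum_i G i x).
Proof.
move=> cg x u; rewrite dot_mean /average -mulrDr -big_split /=.
by rewrite ler_wpM2l ?invr_ge0// ler_sum// => i _; exact: cg.
Qed.

Lemma smooth_grad_average L (g : 'I_N -> 'rV[R]_d -> R)
    (G : 'I_N -> 'rV[R]_d -> 'rV[R]_d) :
  (forall i, smooth_grad L (g i) (G i)) ->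
  smooth_grad L (average g) (fun x => N%:R^-1 *: \sum_i G i x).
Proof.
move=> sg x u; rewrite dot_mean /average -[L / 2 * _]mean_cst.
rewrite -!mulrDr -!big_split /=.
by rewrite ler_wpM2l ?invr_ge0// ler_sum// => i _; exact: sg.
Qed.

Lemma average_prox (sigma : R) (g : 'I_N -> 'rV[R]_d -> R) y :
  average (fun i => prox sigma (g i) y) = prox sigma (average g) y.
Proof.
apply: funext => x; rewrite /average /prox big_split mulrDr /=; congr (_ + _).
exact: mean_cst.
Qed.

End Closure.

(** * One SVRG stage with i.i.d. indices *)

Section SVRG.
Variables (R : realType) (d N : nat).
Hypothesis N_gt0 : (0 < N)%N.
Variables (g : 'I_N -> 'rV[R]_d -> R) (G : 'I_N -> 'rV[R]_d -> 'rV[R]_d).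
Variables (L mu eta : R) (w : 'rV[R]_d).
Hypotheses (L_gt0 : 0 < L) (mu_gt0 : 0 < mu).
Hypothesis convG : forall i, convex_grad (g i) (G i).
Hypothesis smoothG : forall i, smooth_grad L (g i) (G i).

Local Notation phi := (average g).
Local Notation Gphi := (fun x => N%:R^-1 *: \sum_(i < N) G i x).
Local Notation iunif := (dunif R (enum 'I_N)).

Hypothesis w_min : minimizer phi w.
Hypothesis growth : forall x, mu / 2 * dot (x - w) (x - w) <= phi x - phi w.
Hypotheses (etaL_ge : 16^-1 <= eta * L) (etaL_le : eta * L <= 8^-1).

Let Delta x := phi x - phi w.

Let upd (xt : 'rV[R]_d) (t : nat) (s : 'rV[R]_d * 'rV[R]_d) (i : 'I_N) :=
  let x' := s.1 - eta *: (G i s.1 - G i xt + Gphi xt) in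
  (x', t.+1%:R^-1 *: (x' + t%:R *: s.2)).

Definition svrg_step_iid xt t s : dist R ('rV[R]_d * 'rV[R]_d) :=
  dbind iunif (fun i => dret R (upd xt t s i)).

Definition svrg_stage_iid (T : nat) (xt : 'rV[R]_d) : dist R 'rV[R]_d :=
  dbind (diter T (svrg_step_iid xt) (xt, 0)) (fun s => dret R s.2).

Lemma stochastic_svrg_step xt t s : stochastic (svrg_step_iid xt t s).
Proof.
apply: stochastic_bind => [|i]; first exact: stochastic_iunif.
exact: stochastic_ret.
Qed.

Lemma stochastic_svrg_stage T xt : stochastic (svrg_stage_iid T xt).
Proof.
apply: stochastic_bind => [|s]; last exact: stochastic_ret.
by apply: stochastic_iter => t s; exact: stochastic_svrg_step.
Qed.

Lemma convPhi : convex_grad phi Gphi. Proof. exact: convex_grad_average. Qed.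
Lemma smoothPhi : smooth_grad L phi Gphi. Proof. exact: smooth_grad_average. Qed.

Lemma Gphi_min : Gphi w = 0.
Proof. exact: minimizer_grad0 L_gt0 smoothPhi w_min. Qed.

Lemma dexpect_dot (v : 'I_N -> 'rV[R]_d) u :
  dexpect iunif (fun i => dot (v i) u) = dot (N%:R^-1 *: \sum_i v i) u.
Proof. by rewrite dot_mean dexpect_iunif. Qed.

(** [grad_diff_sqr] is averaged over [i]; the linear terms cancel because [Gphi w = 0]. *)
Lemma mean_grad_diff x :
  dexpect iunif (fun i => dot (G i x - G i w) (G i x - G i w)) <= 2 * L * Delta x.
Proof.
apply: (@le_trans _ _ (dexpect iunif (fun i =>
    2 * L * (g i x - g i w) + (- (2 * L)) * dot (G i w) (x - w)))).
  apply: stochastic_le => [|i]; first exact: stochastic_iunif.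
  have := grad_diff_sqr L_gt0 (convG i) (smoothG i) x w; lra.
rewrite dexpectD !dexpectZ dexpect_dot Gphi_min dot0l mulr0 addr0.
by rewrite dexpect_iunif /Delta /average -mulrBr -sumrB.
Qed.

Lemma svrg_unbiased x xt u :
  dexpect iunif (fun i => dot (G i x - G i xt + Gphi xt) u) = dot (Gphi x) u.
Proof.
transitivity (dexpect iunif (fun i => dot (G i x) u + (-1 * dot (G i xt) u
    + dot (Gphi xt) u))).
  by apply: eq_dexpect => i; rewrite (dotDl _ _ u) (dotDl _ _ u) dotNl; ring.
rewrite !dexpectD dexpectZ (stochastic_cst (dot (Gphi xt) u)); last exact: stochastic_iunif.
by rewrite !dexpect_dot; ring.
Qed.

(** The estimator is [a - (b - m)] with [m] the mean of [b]. Its square is at most twice the squares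
    of [a] and [b - m], and centring [b] only lowers its second moment. *)
Lemma svrg_variance x xt :
  dexpect iunif (fun i => dot (G i x - G i xt + Gphi xt) (G i x - G i xt + Gphi xt))
  <= 4 * L * (Delta x + Delta xt).
Proof.
pose a i := G i x - G i w; pose b i := G i xt - G i w; pose m := Gphi xt.
apply: (@le_trans _ _ (dexpect iunif (fun i => 2 * dot (a i) (a i) +
    (2 * dot (b i) (b i) + (-4 * dot (b i) m + 2 * dot m m))))).
  apply: stochastic_le => [|i]; first exact: stochastic_iunif.
  have -> : G i x - G i xt + Gphi xt = a i - b i + m.
    by rewrite /a /b opprB addrA subrK.
  move: (a i) (b i) m => {a b}a b m; have := dotxx_ge0 (a + b - m).
  by rewrite !dotE (dotC b a) (dotC m a) (dotC m b); lra.
have Pi := stochastic_iunif R N_gt0.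
have mb : N%:R^-1 *: \sum_i b i = m.
  by rewrite /b sumrB scalerBr Gphi_min subr0.
rewrite !dexpectD !dexpectZ (stochastic_cst (dot m m) Pi) dexpect_dot mb.
have := mean_grad_diff x; have := mean_grad_diff xt; have := dotxx_ge0 m.
rewrite -/(a _) -/(b _) => ? ? ?.
lra.
Qed.

Let v xt x i := G i x - G i xt + Gphi xt.

Lemma eta_gt0 : 0 < eta.
Proof.
by rewrite -(pmulr_lgt0 _ L_gt0); apply: lt_le_trans etaL_ge; rewrite invr_gt0.
Qed.

Lemma svrg_dist_step x xt :
  dexpect iunif (fun i => dot (x - eta *: v xt x i - w) (x - eta *: v xt x i - w))
  <= dot (x - w) (x - w) - 2 * eta * Delta x
     + 4 * eta * (eta * L) * (Delta x + Delta xt).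
Proof.
have Pi := stochastic_iunif R N_gt0.
rewrite (@eq_dexpect _ _ _ _ (fun i => dot (x - w) (x - w) +
    (- (2 * eta) * dot (v xt x i) (x - w) + eta ^+ 2 * dot (v xt x i) (v xt x i))));
  last first.
  move=> i; rewrite addrAC; move: (x - w) (v xt x i) => a b.
  by rewrite !dotE (dotC b a); ring.
rewrite !dexpectD !dexpectZ (stochastic_cst (dot (x - w) (x - w)) Pi) svrg_unbiased.
have E0 := eta_gt0.
have := ler_wpM2l (sqr_ge0 eta) (svrg_variance x xt).
have := ler_wpM2l (ltW E0) (convPhi x w).
have -> : w - x = - (x - w) by rewrite opprB.
rewrite dotNr /Delta /v; lra.
Qed.

(** In the smoothness bound along the step, the first-order term averages to [- eta] times a squared
    norm and is dropped. *)
Lemma svrg_phi_step x xt :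
  dexpect iunif (fun i => Delta (x - eta *: v xt x i))
  <= Delta x + 2 * (eta * L) ^+ 2 * (Delta x + Delta xt).
Proof.
have Pi := stochastic_iunif R N_gt0.
apply: (@le_trans _ _ (dexpect iunif (fun i => Delta x +
    (- eta * dot (v xt x i) (Gphi x)
     + L / 2 * eta ^+ 2 * dot (v xt x i) (v xt x i))))).
  apply: (stochastic_le Pi) => i; have := smoothPhi x (x - eta *: v xt x i).
  have -> : x - eta *: v xt x i - x = - (eta *: v xt x i) by rewrite addrAC subrr add0r.
  by rewrite !(dotNl, dotNr, dotZl, dotZr) (dotC (v xt x i)) /Delta; lra.
rewrite dexpectD (stochastic_cst (Delta x) Pi) dexpectD !dexpectZ svrg_unbiased.
have E0 := eta_gt0.
have L2 : 0 <= L / 2 * eta ^+ 2 by rewrite mulr_ge0 ?sqr_ge0// divr_ge0// ltW.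
have := ler_wpM2l L2 (svrg_variance x xt).
have := mulr_ge0 (ltW E0) (dotxx_ge0 (Gphi x)).
rewrite /v; lra.
Qed.

(** Jensen's inequality from the tangent at the mean, where the first-order terms cancel. *)
Lemma phi_mean (t : nat) x xbar :
  t.+1%:R * Delta (t.+1%:R^-1 *: (x + t%:R *: xbar)) <= Delta x + t%:R * Delta xbar.
Proof.
set m := _ *: _.
have mE : t.+1%:R *: m = x + t%:R *: xbar.
  by rewrite /m scalerA mulfV ?scale1r// pnatr_eq0.
have H1 := convPhi m x; have H2 := ler_wpM2l (ler0n R t) (convPhi m xbar).
have H3 : dot (Gphi m) (x - m) + t%:R * dot (Gphi m) (xbar - m) = 0.
  rewrite -dotZr -dotDr scalerBr addrACA -mE -opprD -natr1 scalerDl scale1r.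
  by rewrite (addrC m) subrr dot0r.
by rewrite /Delta -natr1; lra.
Qed.

(* In [W], the weight [A] is the one for which the term in [Delta x] produced
   by the distance at one step pays for the growth of [Delta] at that step. *)
Let e : R := eta * L.
Let A : R := (1 + 2 * e ^+ 2) / (2 * eta * (1 - 2 * e)).
Let B : R := 2 * e ^+ 2 + 2 * e * (1 + 2 * e ^+ 2) / (1 - 2 * e).
Let W (t : nat) (s : 'rV[R]_d * 'rV[R]_d) : R :=
  A * dot (s.1 - w) (s.1 - w) + t%:R * Delta s.2.

Lemma svrg_W_step xt t s :
  dexpect (svrg_step_iid xt t s) (W t.+1) <= W t s + B * Delta xt.
Proof.
have Pi := stochastic_iunif R N_gt0; have E0 := eta_gt0.
have e0 : 0 < 1 - 2 * e by rewrite /e; have := etaL_le; lra.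
have A0 : 0 < A.
  by apply: divr_gt0; [have := sqr_ge0 e; lra|rewrite !mulr_gt0].
rewrite dexpect_bind.
apply: (@le_trans _ _ (dexpect iunif (fun i =>
    A * dot (s.1 - eta *: v xt s.1 i - w) (s.1 - eta *: v xt s.1 i - w) +
    (Delta (s.1 - eta *: v xt s.1 i) + t%:R * Delta s.2)))).
  by apply: (stochastic_le Pi) => i; rewrite dexpect_ret /W lerD2l; exact: phi_mean.
rewrite dexpectD dexpectZ dexpectD (stochastic_cst (t%:R * Delta s.2) Pi).
have H1 := ler_wpM2l (ltW A0) (svrg_dist_step s.1 xt).
have H2 := svrg_phi_step s.1 xt.
have HA : A * eta * (1 - 2 * e) = (1 + 2 * e ^+ 2) / 2.
  by rewrite /A; field; rewrite !gt_eqF.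
have HB : B = 2 * e ^+ 2 + 4 * A * eta * e.
  by rewrite /B /A; field; rewrite !gt_eqF.
rewrite /W HB.
have := congr1 (fun a => a * Delta s.1) HA; rewrite -/e in H1 H2 *; lra.
Qed.

(** Summing [svrg_W_step] bounds [T] times the gap of the average by the initial distance plus
    [T * B * Delta xt]; [growth] and the size of [T] turn the distance into a gap. *)
Lemma svrg_stage_contract (T : nat) xt : 96 * (L / mu) <= T%:R ->
  dexpect (svrg_stage_iid T xt) Delta <= 2^-1 * Delta xt.
Proof.
move=> TL; have Pi := stochastic_iunif R N_gt0; have E0 := eta_gt0.
have T0 : 0 < T%:R :> R by apply: lt_le_trans TL; rewrite mulr_gt0// divr_gt0.
have e0 : 0 < 1 - 2 * e by rewrite /e; have := etaL_le; lra.
have A0 : 0 < A.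
  by apply: divr_gt0; [have := sqr_ge0 e; lra|rewrite !mulr_gt0].
have Pstep t s := stochastic_svrg_step xt t s.
have D0 x : 0 <= Delta x by rewrite subr_ge0.
have it n : dexpect (diter n (svrg_step_iid xt) (xt, 0)) (W n) <=
    A * dot (xt - w) (xt - w) + n%:R * (B * Delta xt).
  (* The initial average 0 is a dummy: its weight in [W 0] is 0. *)
  elim: n => [|n IH] /=; first by rewrite dexpect_ret /W !mul0r.
  rewrite dexpect_bind.
  apply: (@le_trans _ _ (dexpect (diter n (svrg_step_iid xt) (xt, 0))
      (fun s => W n s + B * Delta xt))).
    apply: stochastic_le => [|s]; last exact: svrg_W_step.
    exact: stochastic_iter.
  rewrite dexpectD stochastic_cst; last exact: stochastic_iter.
  by rewrite -natr1; lra.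
rewrite dexpect_bind -(ler_pM2l T0) -dexpectZ.
apply: (@le_trans _ _ (dexpect (diter T (svrg_step_iid xt) (xt, 0)) (W T))).
  apply: stochastic_le => [|s]; first exact: stochastic_iter.
  by rewrite dexpect_ret /W lerDr mulr_ge0 ?dotxx_ge0 ?ltW.
apply: (le_trans (it T)).
have H1 : A * dot (xt - w) (xt - w) <= A * (2 / mu) * Delta xt.
  rewrite -mulrA ler_pM2l// mulrAC ler_pdivlMr//.
  have := growth xt; rewrite /Delta; lra.
have H2 : A * (2 / mu) <= (1 + 2 * e ^+ 2) / (96 * e * (1 - 2 * e)) * T%:R.
  have -> : A * (2 / mu) = (1 + 2 * e ^+ 2) / (96 * e * (1 - 2 * e)) * (96 * (L / mu)).
    by rewrite /A /e; field; rewrite !gt_eqF.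
  rewrite ler_pM2l//; apply: divr_gt0; first by have := sqr_ge0 e; lra.
  by rewrite !mulr_gt0.
have H3 : (1 + 2 * e ^+ 2) / (96 * e * (1 - 2 * e)) + B <= 2^-1.
  have e1 : 0 < e by rewrite mulr_gt0.
  have -> : (1 + 2 * e ^+ 2) / (96 * e * (1 - 2 * e)) + B =
      ((1 + 2 * e ^+ 2) / 96 + 2 * e ^+ 3 + 2 * e ^+ 2) / (e * (1 - 2 * e)).
    by rewrite /B; field; rewrite !gt_eqF.
  rewrite ler_pdivrMr ?mulr_gt0//.
  have a1 : 16^-1 <= e by []. have a2 : e <= 8^-1 by [].
  (* That is, [e - 1 / 16] and [e - 1 / 8] have a nonpositive product. *)
  have sq : e ^+ 2 <= 3 / 16 * e - 128^-1 by nra.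
  have cu : e ^+ 3 <= 8^-1 * e ^+ 2 by rewrite exprS ler_wpM2r ?sqr_ge0.
  lra.
have H4 := ler_wpM2r (D0 xt) H2.
have H5 := ler_wpM2r (mulr_ge0 (ltW T0) (D0 xt)) H3.
lra.
Qed.

End SVRG.

(** * Accelerated proximal steps, exact and inexact *)

Section Accelerated.
Variables (R : realType) (d : nat).
Implicit Types (u v w x y z : 'rV[R]_d) (f : 'rV[R]_d -> R).

(* One step of Nesterov's scheme on the Moreau envelope, in coordinates centred
   at the minimizer: [Y] is the extrapolated point, [X] and [Z] the old and new
   iterates, [W] and [P] the old and new momentum points, [M = mu + sigma] and
   [s ^+ 2 = mu / M].  Taking [W], [Y], [P] as the independent vectors makes the
   inequality polynomial. *)
Lemma estimate_sequence (M s fx fz fs : R) (W Y P : 'rV[R]_d) :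
  0 < M -> 0 < s < 1 ->
  let X := (1 + s) *: Y - s *: W in
  let Z := (1 - s) *: X + s *: P in
  let mu := s ^+ 2 * M in
  let sigma := (1 - s ^+ 2) * M in
  fz + sigma * dot (Y - Z) (- Z) + mu / 2 * dot Z Z <= fs ->
  fz + sigma * dot (Y - Z) (X - Z) + mu / 2 * dot (X - Z) (X - Z) <= fx ->
  fz + sigma / 2 * dot (Z - Y) (Z - Y) - fs + mu / 2 * dot P P <=
  (1 - s) * (fx - fs + mu / 2 * dot W W).
Proof.
move=> M0 /andP[s0 s1] X Z mu sigma h1 h2.
have s1' : 0 <= 1 - s by rewrite subr_ge0 ltW.
have H1 := ler_wpM2l (ltW s0) h1; have H2 := ler_wpM2l s1' h2.
have mu0 : 0 <= mu / 2 by rewrite /mu divr_ge0// mulr_ge0 ?sqr_ge0// ltW.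
have H3 := mulr_ge0 (mulr_ge0 (mulr_ge0 s1' (ltW s0)) mu0) (dotxx_ge0 (W - Y)).
have H4 := mulr_ge0 (mulr_ge0 s1' mu0) (dotxx_ge0 (X - Y)).
rewrite /Z /X /mu /sigma in H1 H2 H3 H4 *.
rewrite !dotE (dotC P Y) (dotC P W) (dotC Y W) in H1 H2 H3 H4 *.
lra.
Qed.


Section Step.
Variables (mu sigma s : R) (f : 'rV[R]_d -> R) (G : 'rV[R]_d -> 'rV[R]_d).
Variable xs : 'rV[R]_d.
Hypotheses (mu_gt0 : 0 < mu) (sigma_gt0 : 0 < sigma).
Hypotheses (s_gt0 : 0 < s) (s_sqr : s ^+ 2 = mu / (mu + sigma)).
Hypothesis scf : forall x u,
  f x + dot (G x) (u - x) + mu / 2 * dot (u - x) (u - x) <= f u.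
Hypothesis f_min : minimizer f xs.

(** Nesterov's auxiliary point [v], determined by [(1 + s) *: y = x + s *: v]. *)
Definition momentum x y : 'rV[R]_d := s^-1 *: ((1 + s) *: y - x).

Definition lyapunov x y : R :=
  f x - f xs + mu / 2 * dot (momentum x y - xs) (momentum x y - xs).

Lemma mu_sigma_gt0 : 0 < mu + sigma. Proof. by rewrite addr_gt0. Qed.

Lemma s_lt1 : s < 1.
Proof.
rewrite -(ltr_sqr (ltW s_gt0) ler01)//.
by rewrite s_sqr expr1n ltr_pdivrMr ?mu_sigma_gt0// mul1r ltrDl.
Qed.

Lemma muE : mu = s ^+ 2 * (mu + sigma).
Proof. by rewrite s_sqr divfK// gt_eqF// mu_sigma_gt0. Qed.

Lemma sigmaE : sigma = (1 - s ^+ 2) * (mu + sigma).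
Proof. by rewrite mulrBl -muE mul1r addrAC subrr add0r. Qed.

Section ProxPoint.
Variables x y z : 'rV[R]_d.
Hypothesis z_grad : G z = sigma *: (y - z).

(** At [z] the first-order terms of [f] and of the quadratic cancel, and the two moduli add. *)
Lemma prox_growth u : (mu + sigma) / 2 * dot (u - z) (u - z) <=
  prox sigma f y u - prox sigma f y z.
Proof.
rewrite (prox_expand _ _ _ z u); have := scf z u.
by rewrite z_grad -(opprB y z) scalerN dotNl; lra.
Qed.

(** [scf] at [z] towards [xs] and towards [x] gives the two hypotheses of [estimate_sequence]; an
    exact proximal point moves the momentum point to [x + s^-1 *: (z - x)]. *)
Lemma exact_step :
  prox sigma f y z - f xs + mu / 2 *
    dot (x + s^-1 *: (z - x) - xs) (x + s^-1 *: (z - x) - xs) <=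
  (1 - s) * lyapunov x y.
Proof.
have M0 := mu_sigma_gt0; have s0 : s != 0 by rewrite gt_eqF.
have s01 : 0 < s < 1 by rewrite s_gt0 s_lt1.
have h1 := scf z xs; have h2 := scf z x.
set P := x + _ - xs; set W := momentum x y - xs.
have XE : (1 + s) *: (y - xs) - s *: W = x - xs.
  apply/rowP => j; rewrite /W /momentum !mxE; field.
  exact: s0.
have ZE : (1 - s) *: (x - xs) + s *: P = z - xs.
  apply/rowP => j; rewrite /P !mxE; field.
  exact: s0.
have yzE : y - z = (y - xs) - (z - xs) by rewrite opprB addrA subrK.
have xzE : x - z = (x - xs) - (z - xs) by rewrite opprB addrA subrK.
have zyE : z - y = (z - xs) - (y - xs) by rewrite opprB addrA subrK.
have xsE : xs - z = - (z - xs) by rewrite opprB.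
rewrite /lyapunov /prox enorm_sqr -/W.
rewrite z_grad xsE yzE dotZl in h1; rewrite z_grad xzE yzE dotZl in h2.
have := @estimate_sequence (mu + sigma) s (f x) (f z) (f xs) W (y - xs) P M0 s01.
rewrite /= XE ZE -muE -sigmaE zyE; apply => //.
by move: h1; rewrite !(dotNl, dotNr) opprK.
Qed.

Lemma inexact_step xp :
  lyapunov xp (xp + ((1 - s) / (1 + s)) *: (xp - x)) <=
  (1 + s / 2) * ((1 - s) * lyapunov x y) +
  (2 + 2 / s) * (prox sigma f y xp - prox sigma f y z).
Proof.
set xi := prox _ _ _ _ - _.
have s0 : s != 0 by rewrite gt_eqF.
have s1 : 1 + s != 0 by rewrite gt_eqF// addr_gt0.
set P := x + s^-1 *: (z - x) - xs; set e := xp - z.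
have -> : lyapunov xp (xp + ((1 - s) / (1 + s)) *: (xp - x)) =
    f xp - f xs + mu / 2 * dot (P + s^-1 *: e) (P + s^-1 *: e).
  rewrite /lyapunov (_ : momentum _ _ - xs = P + s^-1 *: e)//.
  apply/rowP => j; rewrite /P /e /momentum !mxE; field.
  by rewrite s0 s1.
have He : (mu + sigma) / 2 * dot e e <= xi := prox_growth xp.
have E1 := exact_step; rewrite -/P in E1.
have Ef : f xp <= prox sigma f y xp.
  by rewrite /prox lerDl mulr_ge0 ?sqr_ge0// divr_ge0// ltW.
have Es : f xs <= prox sigma f y z.
  apply: le_trans (f_min z) _.
  by rewrite /prox lerDl mulr_ge0 ?sqr_ge0// divr_ge0// ltW.
have s2 : 0 < s / 2 by rewrite divr_gt0.
have young : dot (P + s^-1 *: e) (P + s^-1 *: e) <=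
    (1 + s / 2) * dot P P + (1 + 2 / s) * (s ^- 2 * dot e e).
  have sq (a : R) : dot (P + a *: e) (P + a *: e) =
      dot P P + 2 * a * dot P e + a ^+ 2 * dot e e.
    by move: P e {E1 He} => P e; rewrite !dotE (dotC e P); ring.
  (* Young's inequality comes from the square of [P - (2 / s ^+ 2) *: e]. *)
  rewrite sq; have := mulr_ge0 (ltW s2) (dotxx_ge0 (P + (- (2 / s ^+ 2)) *: e)).
  rewrite sq.
  have -> : s / 2 * (dot P P + 2 * - (2 / s ^+ 2) * dot P e
      + (- (2 / s ^+ 2)) ^+ 2 * dot e e) =
      s / 2 * dot P P - 2 * s^-1 * dot P e + 2 / s * (s ^- 2 * dot e e).
    by field.
  by rewrite exprVn; lra.
have mu2 : 0 <= mu / 2 by rewrite divr_ge0// ltW.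
have Y := ler_wpM2l mu2 young.
have Em : mu / 2 * (s ^- 2 * dot e e) = (mu + sigma) / 2 * dot e e.
  by rewrite {1}muE; field.
have Y1 : 0 <= 1 + 2 / s by rewrite addr_ge0// divr_ge0// ltW.
have Y2 := ler_wpM2l Y1 He.
have Y3 := ler_wpM2l (addr_ge0 ler01 (ltW s2)) E1.
(* Allows the factor [1 + s / 2] on all of [exact_step], function gap included. *)
have Y4 : 0 <= s / 2 * (prox sigma f y z - f xs).
  by rewrite mulr_ge0 ?subr_ge0// ltW.
have Y5 : mu / 2 * ((1 + s / 2) * dot P P + (1 + 2 / s) * (s ^- 2 * dot e e)) =
    (1 + s / 2) * (mu / 2 * dot P P) + (1 + 2 / s) * ((mu + sigma) / 2 * dot e e).
  by rewrite -Em; ring.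
rewrite Y5 in Y; rewrite /xi in Y2 *; lra.
Qed.

(** Controls the gap from which the stages start. [x - y] is [s / (1 + s)] times the difference of
    the centred [x] and momentum point, and [sigma * s ^+ 2 <= mu] converts its square into Lyapunov
    terms. *)
Lemma initial_gap : G xs = 0 ->
  prox sigma f y x - prox sigma f y z <= 3 * lyapunov x y.
Proof.
move=> gxs; have s0 : s != 0 by rewrite gt_eqF.
have Es : f xs <= prox sigma f y z.
  apply: le_trans (f_min z) _.
  by rewrite /prox lerDl mulr_ge0 ?sqr_ge0// divr_ge0// ltW.
have gx := scf xs x; rewrite gxs dot0l addr0 in gx.
rewrite /lyapunov; set W := momentum x y - xs.
have xyE : (1 + s) *: (x - y) = s *: ((x - xs) - W).
  apply/rowP => j; rewrite /W /momentum !mxE; field.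
  exact: s0.
have D1 : dot (x - y) (x - y) <= s ^+ 2 * (2 * dot (x - xs) (x - xs) + 2 * dot W W).
  have E : (1 + s) ^+ 2 * dot (x - y) (x - y) =
      s ^+ 2 * dot (x - xs - W) (x - xs - W).
    have : dot ((1 + s) *: (x - y)) ((1 + s) *: (x - y)) =
        dot (s *: (x - xs - W)) (s *: (x - xs - W)) by rewrite xyE.
    by rewrite !(dotZl, dotZr) !mulrA -!expr2.
  have H1 : dot (x - xs - W) (x - xs - W) <= 2 * dot (x - xs) (x - xs) + 2 * dot W W.
    have := dotxx_ge0 (x - xs + W); move: (x - xs) W {xyE E} => a b.
    by rewrite !dotE (dotC b a); lra.
  have H2 := ler_wpM2l (sqr_ge0 s) H1; rewrite -E in H2.
  apply: le_trans H2; apply: ler_peMl; first exact: dotxx_ge0.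
  by rewrite exprn_ege1 ?lerDl ?ltW.
have ss : sigma * s ^+ 2 <= mu.
  rewrite s_sqr mulrA ler_pdivrMr ?mu_sigma_gt0// mulrC ler_pM2l//.
  by rewrite lerDr ltW.
have D0 : 0 <= 2 * dot (x - xs) (x - xs) + 2 * dot W W.
  by rewrite addr_ge0// mulr_ge0// dotxx_ge0.
have D2 := ler_wpM2l (ltW (divr_gt0 sigma_gt0 (ltr0n _ 2))) D1.
have D3 := ler_wpM2r D0 ss.
rewrite {1}/prox enorm_sqr; have := f_min x.
have D4 : 0 <= mu / 2 * dot W W by rewrite mulr_ge0 ?dotxx_ge0// divr_ge0// ltW.
lra.
Qed.

End ProxPoint.
End Step.
End Accelerated.

(** * The outer loop with i.i.d. indices *)

Section OuterLoop.
Variables (R : realType) (d N : nat).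
Hypothesis N_gt0 : (0 < N)%N.
Variables (F : 'I_N -> 'rV[R]_d -> R) (L mu sigma eta s : R) (xs : 'rV[R]_d).
Variables (T K : nat).
Local Notation f := (average F).
Hypotheses (L_gt0 : 0 < L) (mu_gt0 : 0 < mu) (sigma_gt0 : 0 < sigma).
Hypotheses (s_gt0 : 0 < s) (s_sqr : s ^+ 2 = mu / (mu + sigma)).
Hypothesis F_conv : forall i, convex (F i).
Hypothesis F_smooth : forall i, smooth L (F i).
Hypothesis f_sc : strongly_convex mu f.
Hypothesis f_min : minimizer f xs.
Hypotheses (eta_ge : 16^-1 <= eta * (L + sigma)) (eta_le : eta * (L + sigma) <= 8^-1).
Hypothesis T_ge : 96 * ((L + sigma) / (mu + sigma)) <= T%:R.
Hypothesis K_ge : (2^-1) ^+ K <= s ^+ 3 / 24.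

Definition outer_step_iid (beta : R) (st : 'rV[R]_d * 'rV[R]_d) :
    dist R ('rV[R]_d * 'rV[R]_d) :=
  dbind (diter K (fun=> svrg_stage_iid (fun i => grad (prox sigma (F i) st.2)) eta T) st.1)
        (fun x' => dret R (x', x' + beta *: (x' - st.1))).

Lemma stochastic_outer_step beta st : stochastic (outer_step_iid beta st).
Proof.
apply: stochastic_bind => [|v]; last exact: stochastic_ret.
by apply: stochastic_iter => t u; exact: stochastic_svrg_stage.
Qed.

Let dF i x : differentiable (F i) x := (F_smooth i).1 x.
Let cF i : convex_grad (F i) (grad (F i)) := convex_gradP (F_smooth i).1 (F_conv i).
Let sF i : smooth_grad L (F i) (grad (F i)) := smooth_gradP (F_smooth i).

Lemma grad_averageE : grad f = fun x => N%:R^-1 *: \sum_i grad (F i) x.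
Proof. by apply: funext => x; rewrite grad_average. Qed.

Lemma f_convex_grad : convex_grad f (grad f).
Proof. by rewrite grad_averageE; exact: convex_grad_average. Qed.

Lemma f_smooth_grad : smooth_grad L f (grad f).
Proof. by rewrite grad_averageE; exact: smooth_grad_average. Qed.

Lemma f_strong x u :
  f x + dot (grad f x) (u - x) + mu / 2 * dot (u - x) (u - x) <= f u.
Proof. exact: (strong_convexity mu_gt0 L_gt0 f_convex_grad f_smooth_grad). Qed.

Lemma grad_proxE i y : grad (prox sigma (F i) y) = fun x => grad (F i) x + sigma *: (x - y).
Proof. by apply: funext => x; rewrite grad_prox. Qed.

Lemma stages_contract y z x : minimizer (prox sigma f y) z ->
  (forall u, (mu + sigma) / 2 * dot (u - z) (u - z) <=
     prox sigma f y u - prox sigma f y z) ->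
  dexpect (diter K (fun=> svrg_stage_iid (fun i => grad (prox sigma (F i) y)) eta T) x)
    (fun u => prox sigma f y u - prox sigma f y z)
  <= (2^-1) ^+ K * (prox sigma f y x - prox sigma f y z).
Proof.
move=> zmin zgrow.
elim: K => [|k IH] /=; first by rewrite dexpect_ret expr0 mul1r.
rewrite dexpect_bind.
apply: (@le_trans _ _ (dexpect (diter k (fun=> svrg_stage_iid
    (fun i => grad (prox sigma (F i) y)) eta T) x)
    (fun u => 2^-1 * (prox sigma f y u - prox sigma f y z)))); last first.
  by rewrite dexpectZ exprS -mulrA ler_pM2l// invr_gt0.
apply: stochastic_le => [|u].
  by apply: stochastic_iter => t v; exact: stochastic_svrg_stage.
have := @svrg_stage_contract R d N N_gt0 (fun i => prox sigma (F i) y)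
  (fun i => grad (prox sigma (F i) y)) (L + sigma) (mu + sigma) eta z.
rewrite average_prox//; apply => //; rewrite ?addr_gt0//.
- by move=> i; rewrite grad_proxE; apply: convex_grad_prox => //; exact: ltW.
- by move=> i; rewrite grad_proxE; exact: smooth_grad_prox.
Qed.

Lemma outer_contract (st : 'rV[R]_d * 'rV[R]_d) :
  dexpect (outer_step_iid ((1 - s) / (1 + s)) st)
    (fun st' => lyapunov mu s f xs st'.1 st'.2)
  <= (1 - s / 2) * lyapunov mu s f xs st.1 st.2.
Proof.
case: st => x y /=; rewrite dexpect_bind /=.
have [z zmin] := prox_min_exists y sigma_gt0 (fun x => differentiable_average (dF ^~ x)) f_min.
have zgrad : grad f z = sigma *: (y - z).
  have := minimizer_grad0 (addr_gt0 L_gt0 sigma_gt0)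
    (smooth_grad_prox sigma y f_smooth_grad) zmin.
  by move/eqP; rewrite addr_eq0 -scalerN opprB => /eqP.
have gxs : grad f xs = 0 := minimizer_grad0 L_gt0 f_smooth_grad f_min.
have zgrow := prox_growth (G := grad f) f_strong zgrad.
have Pst : stochastic (diter K (fun=> svrg_stage_iid
    (fun i => grad (prox sigma (F i) y)) eta T) x).
  by apply: stochastic_iter => t u; exact: stochastic_svrg_stage.
set V := lyapunov mu s f xs x y.
have step := inexact_step (G := grad f) mu_gt0 sigma_gt0 s_gt0 s_sqr f_strong f_min x zgrad.
apply: (@le_trans _ _ (dexpect (diter K (fun=> svrg_stage_iid
    (fun i => grad (prox sigma (F i) y)) eta T) x)
    (fun u => (1 + s / 2) * ((1 - s) * V) + (2 + 2 / s) *
       (prox sigma f y u - prox sigma f y z)))).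
  apply: stochastic_le => // u; rewrite dexpect_ret /=.
  exact: step.
rewrite dexpectD stochastic_cst// dexpectZ.
have S := stages_contract x zmin zgrow.
have I := initial_gap (G := grad f) mu_gt0 sigma_gt0 s_gt0 s_sqr f_strong f_min x y z gxs.
have s1 : s < 1 := s_lt1 mu_gt0 sigma_gt0 s_gt0 s_sqr.
have a0 : 0 <= 2 + 2 / s by rewrite addr_ge0// divr_ge0// ltW.
have G0 : 0 <= prox sigma f y x - prox sigma f y z by rewrite subr_ge0.
have V0 : 0 <= V by move: I; rewrite -/V; lra.
have S1 := ler_wpM2r G0 K_ge.
have S2 : s ^+ 3 / 24 * (prox sigma f y x - prox sigma f y z) <= s ^+ 3 / 24 * (3 * V).
  by apply: ler_wpM2l; [rewrite divr_ge0// exprn_ge0// ltW|exact: I].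
have S3 := ler_wpM2l a0 (le_trans S (le_trans S1 S2)).
have E : (2 + 2 / s) * (s ^+ 3 / 24 * (3 * V)) = (s ^+ 3 + s ^+ 2) / 4 * V.
  by field; rewrite gt_eqF.
(* The error may cost [s ^+ 2 / 2], since [(1 + s / 2) * (1 - s) + s ^+ 2 / 2] is exactly
   [1 - s / 2]. *)
have S4 : (s ^+ 3 + s ^+ 2) / 4 * V <= s ^+ 2 / 2 * V.
  apply: ler_wpM2r => //; have : s ^+ 3 <= s ^+ 2 by rewrite exprS ler_piMl ?sqr_ge0// ltW.
  lra.
rewrite E in S3; lra.
Qed.

Lemma outer_loop P x0 :
  dexpect (diter P (fun=> outer_step_iid ((1 - s) / (1 + s))) (x0, x0))
    (fun st => f st.1 - f xs)
  <= (1 - s / 2) ^+ P * (2 * (f x0 - f xs)).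
Proof.
have s1 : s < 1 := s_lt1 mu_gt0 sigma_gt0 s_gt0 s_sqr.
have r0 : 0 <= 1 - s / 2 by lra.
have Pst n (st : 'rV[R]_d * 'rV[R]_d) :
    stochastic (diter n (fun=> outer_step_iid ((1 - s) / (1 + s))) st).
  by apply: stochastic_iter => _ u; exact: stochastic_outer_step.
have gxs : grad f xs = 0 := minimizer_grad0 L_gt0 f_smooth_grad f_min.
(* The initial momentum point is [x0], and strong convexity at [xs] bounds its quadratic term by the
   gap. *)
have V0 : lyapunov mu s f xs x0 x0 <= 2 * (f x0 - f xs).
  rewrite /lyapunov (_ : momentum s x0 x0 = x0).
    by have := f_strong xs x0; rewrite gxs dot0l; lra.
  by apply/rowP => j; rewrite /momentum !mxE; field; rewrite gt_eqF.
apply: (@le_trans _ _ (dexpect (diter P (fun=> outer_step_iid ((1 - s) / (1 + s)))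
    (x0, x0)) (fun st => lyapunov mu s f xs st.1 st.2))).
  apply: stochastic_le => // st; rewrite /lyapunov lerDl mulr_ge0 ?dotxx_ge0//.
  by rewrite divr_ge0// ltW.
apply: le_trans (ler_wpM2l (exprn_ge0 P r0) V0).
elim: P => [|n IH] /=; first by rewrite dexpect_ret mul1r.
rewrite dexpect_bind exprS -mulrA.
apply: le_trans (ler_wpM2l r0 IH); rewrite -dexpectZ.
by apply: stochastic_le => // st; exact: outer_contract.
Qed.

End OuterLoop.

(** * Reduction of DASVRG to i.i.d. sampling *)

Section Reduction.
Variables (R : realType) (d m n : nat).
Local Notation N := (m * n)%N.
Hypothesis N_gt0 : (0 < N)%N.
Variables (nt T K P : nat) (eta sigma : R) (F : 'I_N -> 'rV[R]_d -> R).
Hypothesis nt_gt0 : (0 < nt)%N.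

(** Each index lies in exactly one part, so the sums of the machines regroup into the full sum. *)
Lemma full_grad_part (a : {ffun 'I_N -> 'I_m}) (G : 'I_N -> 'rV[R]_d -> 'rV[R]_d) x :
  full_grad (part a) G x = N%:R^-1 *: \sum_i G i x.
Proof.
rewrite /full_grad; congr (_ *: _); rewrite (partition_big a predT)//=.
by apply: eq_bigr => j _; apply: eq_bigl => i; rewrite inE.
Qed.

Section Sim.
Variables (Q : nat) (Lam : nat -> (pool N -> R) -> R) (a : {ffun 'I_N -> 'I_m}).
Hypothesis LamP : stock Q Lam.

Lemma sim_svrg_stage (G : 'I_N -> 'rV[R]_d -> 'rV[R]_d) l :
  sim Q Lam T (svrg_stage T eta (part a) G l) (svrg_stage_iid G eta T).
Proof.
have S1 xt t : sim Q Lam 1 (svrg_step eta G xt (full_grad (part a) G xt) t)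
    (svrg_step_iid G eta xt t).
  have := sim_draw LamP (fun (s : 'rV[R]_d * 'rV[R]_d) i =>
    let x' := s.1 - eta *: (G i s.1 - G i xt + full_grad (part a) G xt) in
    (x', t.+1%:R^-1 *: (x' + t%:R *: s.2))).
  congr sim; apply: funext => s; last first.
    by rewrite /svrg_step_iid full_grad_part.
  by case: s => w [x xbar].
have S2 xt := sim_iter T (S1 xt); rewrite muln1 in S2.
exact: (sim_comp (fun xt => (xt, 0)) (fun xt => sim_map (fun _ s => s.2) (S2 xt))).
Qed.

Lemma sim_outer_step (alpha : nat -> R) (beta : R) p : betaS alpha p = beta ->
  sim Q Lam (K * T) (outer_step T K eta sigma alpha F (part a) p)
    (outer_step_iid F sigma eta T K beta).
Proof.
move=> betaE.
have S1 y := sim_iter K (sim_svrg_stage (fun i => grad (prox sigma (F i) y))).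
have := sim_map (fun (st : 'rV[R]_d * 'rV[R]_d) x' => (x', x' + beta *: (x' - st.1)))
  (sim_comp (fun st : 'rV[R]_d * 'rV[R]_d => st.1) (fun st => S1 st.2)).
congr sim; apply: funext => -[w [xh y]] /=.
by rewrite betaE.
Qed.

End Sim.

(** The test function ignores the pool, so it is invariant under permutations, and once all
    [T * K * P] indices are drawn the stock functional returns it unchanged. *)
Lemma dasvrg_iid (a : {ffun 'I_N -> 'I_m}) (alpha : nat -> R) (beta : R) x0
    (h : 'rV[R]_d -> R) : (forall p, betaS alpha p = beta) ->
  dexpect (dunif R (enum {: (T * K * P).-tuple 'I_N})) (fun r =>
    dexpect (diter P (outer_step T K eta sigma alpha F (part a))
              (pool_init nt r, (x0, x0))) (fun s => h s.2.1)) =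
  dexpect (diter P (fun=> outer_step_iid F sigma eta T K beta) (x0, x0))
    (fun st => h st.1).
Proof.
move=> betaE; have [Lam LamP Lam0] := pool_stock R N_gt0 nt_gt0 (T * K * P).
have S := sim_iter P (fun p => sim_outer_step a LamP (betaE p)).
have [Sinv SE] := S (fun _ st => h st.1) (x0, x0) (fun _ _ _ _ => erefl).
rewrite (avg_tuple _ (fun r => dexpect (diter P (outer_step T K eta sigma alpha F
  (part a)) (pool_init nt r, (x0, x0))) (fun s => h s.2.1))).
rewrite -(Lam0 _ Sinv) SE ?add0n; last by rewrite mulnC (mulnC K).
by apply: eq_dexpect => st; rewrite mulnC (mulnC K) LamP.1.
Qed.

End Reduction.

(** * Bounds on the number of stages *)

Section StageCount.
Variables (R : realType) (mu sigma : R).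
Hypotheses (mu_gt0 : 0 < mu) (sigma_gt0 : 0 < sigma).
Let t := sigma / mu.
Let q := mu / (mu + sigma).
Let s := Num.sqrt q.
Let stage_arg := 4 / (2 - s) + 10368 * sigma / (mu * q * (1 - s / 2) ^+ 2).

Lemma ratioE : q = (1 + t)^-1.
Proof.
by rewrite /q /t; field; rewrite ?gt_eqF ?addr_gt0.
Qed.

Let t_gt0 : 0 < t. Proof. exact: divr_gt0. Qed.

Lemma ratio_gt0 : 0 < q. Proof. by rewrite divr_gt0 ?addr_gt0. Qed.

Lemma ratio_lt1 : q < 1.
Proof. by rewrite ltr_pdivrMr ?addr_gt0// mul1r ltrDl. Qed.

Lemma sqrt_ratio_sqr : s ^+ 2 = q. Proof. by rewrite sqr_sqrtr// ltW// ratio_gt0. Qed.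

Lemma sqrt_ratio_gt0 : 0 < s. Proof. by rewrite sqrtr_gt0 ratio_gt0. Qed.

Lemma sqrt_ratio_lt1 : s < 1.
Proof. by rewrite -sqrtr1 ltr_sqrt// ratio_lt1. Qed.

(** The first summand is at least [4 * (1 - t)], as [1 - t <= q <= (2 - s)^-1], and the second at
    least [8 * t]. *)
Lemma stage_arg_ge : 4 * (1 + t) <= stage_arg.
Proof.
have s0 := sqrt_ratio_gt0; have s1 := sqrt_ratio_lt1; have q0 := ratio_gt0; have q1 := ratio_lt1.
have t0 := t_gt0; have sq := sqrt_ratio_sqr.
have H1 : 4 * (1 - t) <= 4 / (2 - s).
  rewrite ler_pM2l//; apply: (@le_trans _ _ q).
    rewrite ratioE -[_^-1]mul1r ler_pdivlMr; last by lra.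
    by have := sqr_ge0 t; lra.
  rewrite -[_^-1]mul1r ler_pdivlMr; last by lra.
  by rewrite -sq; nra.
rewrite /stage_arg.
have : (8 : R) <= 10368 by lra.
move: (10368 : R) => b b8.
have b0 : 0 < b by lra.
have H2 : b * t <= b * sigma / (mu * q * (1 - s / 2) ^+ 2).
  rewrite /t mulrA ler_pM2l ?mulr_gt0//.
  have a0 : 0 < 1 - s / 2 by lra.
  have den0 := mulr_gt0 (mulr_gt0 mu_gt0 q0) (exprn_gt0 2 a0).
  rewrite lef_pV2 ?posrE//.
  rewrite -mulrA ler_piMr ?(ltW mu_gt0)// mulr_ile1 ?(ltW q0) ?(ltW q1) ?sqr_ge0//.
  by rewrite exprn_ile1// ?(ltW a0)//; lra.
have H3 := ler_wpM2r (ltW t0) b8.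
apply: le_trans (lerD H1 H2); lra.
Qed.

(** Uses [1 - s / 2 >= 1 / 2] and [q^-1 = 1 + t]. *)
Lemma stage_arg_le : stage_arg <= (4 * 10368) * (1 + t) ^+ 2.
Proof.
have s0 := sqrt_ratio_gt0; have s1 := sqrt_ratio_lt1; have q0 := ratio_gt0.
have t0 := t_gt0.
have H1 : 4 / (2 - s) <= 4.
  by rewrite ler_pdivrMr; lra.
rewrite /stage_arg.
have : (1 : R) <= 10368 by lra.
move: (10368 : R) => b b1.
have b0 : 0 < b by lra.
have H2 : b * sigma / (mu * q * (1 - s / 2) ^+ 2) <= 4 * b * (t * (1 + t)).
  have -> : 4 * b * (t * (1 + t)) = b * sigma / (mu * q * (1 / 4)).
    by rewrite ratioE /t; field; rewrite ?gt_eqF ?addr_gt0.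
  have a0 : 0 < 1 - s / 2 by lra.
  have den0 := mulr_gt0 (mulr_gt0 mu_gt0 q0) (exprn_gt0 2 a0).
  rewrite (ler_pM2l (mulr_gt0 b0 sigma_gt0)) lef_pV2 ?posrE//; last first.
    by apply: mulr_gt0; [exact: mulr_gt0|rewrite divr_gt0].
  rewrite (ler_pM2l (mulr_gt0 mu_gt0 q0)).
  by rewrite expr2; nra.
apply: (le_trans (lerD H1 H2)); have := mulr_ge0 (ltW b0) (ltW t0).
rewrite expr2; lra.
Qed.

Variable K : nat.
Hypothesis K_def : K%:Z = Num.ceil (stages_needed mu sigma q).

Lemma ln98_gt0 : 0 < ln (9 / 8 : R).
Proof. by rewrite ln_gt0//; lra. Qed.

Lemma stage_arg_gt0 : 0 < stage_arg.
Proof. by apply: lt_le_trans stage_arg_ge; have := t_gt0; lra. Qed.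

(** Since [(9 / 8) ^+ 3 <= 2], [2 ^+ K] is at least the cube of [stage_arg >= 4 / s ^+ 2], that is
    [64 / s ^+ 6]. *)
Lemma stages_rate : (2^-1 : R) ^+ K <= s ^+ 3 / 24.
Proof.
have s0 := sqrt_ratio_gt0; have s1 := sqrt_ratio_lt1.
have p98 : 0 < 9 / 8 :> R by lra.
have KR : stages_needed mu sigma q <= K%:R.
  by have := ceil_ge (stages_needed mu sigma q); rewrite -K_def.
have H1 : stage_arg <= (9 / 8) ^+ K.
  rewrite -ler_ln ?posrE ?exprn_gt0 ?stage_arg_gt0// lnXn//.
  by move: KR; rewrite /stages_needed ler_pdivrMl ?ln98_gt0// mulr_natr.
have H2 : stage_arg ^+ 3 <= 2 ^+ K.
  apply: (@le_trans _ _ (((9 / 8) ^+ K) ^+ 3)).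
    by rewrite lerXn2r ?nnegrE ?exprn_ge0 ?(ltW stage_arg_gt0) ?(ltW p98).
  have c98 : (9 / 8 : R) ^+ 3 <= 2 by rewrite !exprS expr0; lra.
  by rewrite -exprM mulnC exprM lerXn2r ?nnegrE ?exprn_ge0 ?(ltW p98).
have H3 : 4 / s ^+ 2 <= stage_arg.
  by rewrite sqrt_ratio_sqr ratioE invrK; exact: stage_arg_ge.
have H4 : (4 / s ^+ 2) ^+ 3 <= 2 ^+ K.
  apply: le_trans H2; rewrite lerXn2r ?nnegrE ?(ltW stage_arg_gt0)//.
  by rewrite divr_ge0// sqr_ge0.
have p0 : 0 < (4 / s ^+ 2) ^+ 3 by rewrite exprn_gt0// divr_gt0// exprn_gt0.
have H5 : (2^-1) ^+ K <= ((4 / s ^+ 2) ^+ 3)^-1.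
  have p2 : 0 < 2 ^+ K :> R by exact: exprn_gt0.
  by rewrite exprVn lef_pV2 ?posrE.
apply: le_trans H5 _.
have -> : ((4 / s ^+ 2) ^+ 3)^-1 = s ^+ 3 * (s ^+ 3 / 64) by field; rewrite gt_eqF.
rewrite ler_pM2l ?exprn_gt0//.
have : s ^+ 3 <= 1 by rewrite exprn_ile1// ltW.
lra.
Qed.

(** The summand 1 pays for the ceiling; the factor 2 is the exponent in [stage_arg_le]. *)
Lemma stages_le : K%:R <= 1 + (ln (9 / 8 : R))^-1 * (ln (4 * 10368) + 2 * ln (1 + t)).
Proof.
have KR : K%:R - 1 < stages_needed mu sigma q.
  have := ceil_itv (stages_needed mu sigma q); rewrite -K_def => /andP[+ _].
  by rewrite intrD.
rewrite -lerBlDl; apply: le_trans (ltW KR) _.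
rewrite /stages_needed ler_pM2l ?invr_gt0 ?ln98_gt0//.
have t1 : 0 < 1 + t by have := t_gt0; lra.
have b0 : 0 < 4 * 10368 :> R by lra.
have := stage_arg_le; move: (4 * 10368 : R) b0 => b b0 Mb.
have t2 := exprn_gt0 2 t1.
rewrite (_ : 2 * ln (1 + t) = ln ((1 + t) ^+ 2)); last by rewrite lnXn// mulr_natl.
rewrite -lnM ?posrE//.
by rewrite ler_ln ?posrE ?stage_arg_gt0// mulr_gt0.
Qed.

End StageCount.

Lemma stages_log_bound (R : realType) : exists2 c4 : R, 0 <= c4 &
  forall (mu sigma : R) (K : nat), 0 < mu -> 0 < sigma ->
    K%:Z = Num.ceil (stages_needed mu sigma (mu / (mu + sigma))) ->
    K%:R <= 1 + (ln (9 / 8))^-1 * (c4 + 2 * ln (1 + sigma / mu)).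
Proof.
exists (ln (4 * 10368)); first by apply: ln_ge0; lra.
by move=> mu sigma K mu0 sigma0 KE; exact: stages_le.
Qed.

(** * Constant momentum and the final count *)

Lemma alpha_cst (R : realType) (q : R) (alpha : nat -> R) : 0 < q ->
  alpha_rec q alpha -> forall p, alpha p = Num.sqrt q.
Proof.
move=> q0 [a0 aS]; elim=> [//|p IH].
(* With [alpha p ^+ 2 = q] the recursion reads [alpha p.+1 ^+ 2 = q]; positivity selects the
   root. *)
have [/andP[aS0 _]] := aS p; rewrite IH sqr_sqrtr ?ltW// => E.
have -> : q = alpha p.+1 ^+ 2 by rewrite E; ring.
by rewrite sqrtr_sqr gtr0_norm.
Qed.

(** [0 <= c] settles the empty list, of expectation 0, so no balanced assignment has to be
    exhibited. *)
Lemma dexpect_unif_le (R : realType) (A : Type) (s : seq A) (g : A -> R) (c : R) :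
  0 <= c -> (forall a, g a <= c) -> dexpect (dunif R s) g <= c.
Proof.
move=> c0 gc; rewrite dexpect_unif; have [s0|s0] := posnP (size s).
  by rewrite s0 invr0 mul0r.
rewrite ler_pdivrMl ?ltr0n//; elim: s {s0} => [|a s IH].
  by rewrite big_nil mul0r.
rewrite big_cons /= -natr1 mulrDl mul1r addrC; exact: lerD.
Qed.

Lemma decay (R : realType) (s a : R) (P : nat) : s <= 2 ->
  a <= s / 2 * P%:R -> (1 - s / 2) ^+ P <= expR (- a).
Proof.
move=> s2 aP; apply: (@le_trans _ _ (expR (- (s / 2)) ^+ P)).
  rewrite lerXn2r ?nnegrE ?expR_ge0//; first by lra.
  exact: expR_ge1Dx.
by rewrite -expRM_natr ler_expR mulNr lerN2.
Qed.

(** The floor [delta] accounts for the part of [K] that does not vanish with [kappa / n], and [eps0]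
    keeps [ln eps^-1] away from 0, so that additive constants can be absorbed. *)
Theorem theorem2 (R : realType) (c Delta eps0 delta : R) (hc : 0 < c)
    (hDelta : 0 < Delta) (heps0 : 0 < eps0 < 1) (hdelta : 0 < delta) :
  exists2 A : R, 0 < A &
  forall (d m n C T K : nat) (L mu sigma eta : R) (alpha : nat -> R)
    (F : 'I_(m * n) -> 'rV[R]_d -> R) (x0 xs : 'rV[R]_d),
    let f := average F in
    let kappa := L / mu in
    let nt := (C - n)%N in
    let q := mu / (mu + sigma) in
    (0 < m)%N -> (0 < n)%N -> (n < C < m * n)%N -> c * n%:R <= nt%:R ->
    0 < L -> 0 < mu ->
    (forall i, convex (F i) /\ smooth L (F i)) ->
    strongly_convex mu f ->
    minimizer f xs ->
    f x0 - f xs <= Delta ->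
    sigma = L / n%:R ->
    eta = (16 * L)^-1 ->
    T%:Z = Num.ceil (96 * ((L + sigma) / (mu + sigma))) ->
    K%:Z = Num.ceil (stages_needed mu sigma q) ->
    alpha_rec q alpha ->
    forall eps : R, 0 < eps <= eps0 ->
    exists2 P0 : nat,
      (K * P0)%:R <= A * ((1 + Num.sqrt (kappa / n%:R))
                          * Num.max delta (ln (1 + kappa / n%:R))
                          * ln (eps^-1)) &
      forall P : nat, (P0 <= P)%N -> (T * K * P <= nt * m)%N ->
        eps_optimal f xs eps (dasvrg nt T K P eta sigma alpha F x0).
Proof.
case/andP: heps0 => eps0_gt0 eps0_lt1.
have [c4 c4_ge0 KL_all] := stages_log_bound R.
(* [C1] absorbs [ln (2 * Delta)] into [ln eps^-1 >= l0]; [C2] absorbs the constant part of [K] into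
   the maximum with [delta]. The [l0^-1] in the final constant pays for rounding up [P0]. *)
pose l0 := ln eps0^-1; pose C1 := 1 + `|ln (2 * Delta)| / l0.
pose C2 := delta^-1 + (ln (9 / 8))^-1 * (c4 / delta + 2).
have l0_gt0 : 0 < l0 by rewrite ln_gt0// invf_gt1.
have C1_gt0 : 0 < C1 by rewrite ltr_pwDl// divr_ge0// ltW.
have C2_gt0 : 0 < C2.
  rewrite addr_gt0 ?invr_gt0// mulr_gt0 ?invr_gt0 ?ln98_gt0//.
  by rewrite ltr_wpDl// divr_ge0// ltW.
exists (C2 * (2 * C1 + l0^-1)).
  by rewrite mulr_gt0// addr_gt0 ?mulr_gt0 ?invr_gt0.
move=> d m n C T K L mu sigma eta alpha F x0 xs f kappa nt q m0 n0 /andP[nC _] _.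
move=> L0 mu0 hF fsc fmin fx0 sigmaE etaE TE KE alphaE eps /andP[eps_gt0 eps_le].
have nR : 1 <= n%:R :> R by rewrite ler1n.
have nR0 : 0 < n%:R :> R by rewrite ltr0n.
have sigma0 : 0 < sigma by rewrite sigmaE divr_gt0.
have tE : sigma / mu = kappa / n%:R by rewrite sigmaE /kappa mulrAC.
pose s := Num.sqrt q; pose h := 1 + kappa / n%:R.
have s0 : 0 < s := sqrt_ratio_gt0 mu0 sigma0.
have s1 : s < 1 := sqrt_ratio_lt1 mu0 sigma0.
have q0 : 0 < q := ratio_gt0 mu0 sigma0.
have t0 : 0 < kappa / n%:R by rewrite -tE divr_gt0.
have l_ge : l0 <= ln eps^-1.
  by rewrite ler_ln ?posrE ?invr_gt0// lef_pV2.
have l_gt0 : 0 < ln eps^-1 := lt_le_trans l0_gt0 l_ge.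
pose Lam := C1 * ln eps^-1.
(* The successor makes [P0] exceed [2 / s * Lam], which [decay] needs. *)
pose P0 := (Num.truncn (2 / s * Lam)).+1.
have sV : s^-1 <= 1 + Num.sqrt (kappa / n%:R).
  have -> : s^-1 = Num.sqrt h.
    by rewrite /s -sqrtrV ?(ltW q0)// /q (ratioE mu0 sigma0) invrK tE.
  have sk := sqrtr_ge0 (kappa / n%:R).
  rewrite -(ler_sqr (sqrtr_ge0 h)) ?nnegrE ?addr_ge0//.
  rewrite sqr_sqrtr; last by rewrite addr_ge0// ltW.
  by have := sqr_sqrtr (ltW t0); rewrite /h expr2 => E; nra.
have s_inv1 : 1 <= s^-1 by rewrite invf_ge1// ltW.
have alphaC := alpha_cst q0 alphaE.
have betaC p : betaS alpha p = (1 - s) / (1 + s).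
  rewrite /betaS !alphaC -/s; field.
  by rewrite !gt_eqF ?addr_gt0// expr2 mulr_gt0.
exists P0.
  have Ln : ln (1 + sigma / mu) = ln h by rewrite tE.
  have KL := KL_all _ _ _ mu0 sigma0 KE; rewrite Ln in KL.
  set g := Num.max _ _; have gd : delta <= g by rewrite le_max lexx.
  have gh : ln h <= g by rewrite le_max lexx orbT.
  have g0 : 0 < g := lt_le_trans hdelta gd.
  have K1 : K%:R <= C2 * g.
    apply: (le_trans KL).
    have d1 : 1 <= delta^-1 * g by rewrite ler_pdivlMl// mulr1.
    have d2 := ler_wpM2l c4_ge0 d1.
    have d3 : c4 + 2 * ln h <= (c4 / delta + 2) * g by lra.
    have i0 : 0 <= (ln (9 / 8 : R))^-1 by rewrite invr_ge0 ltW// ln98_gt0.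
    have d4 := ler_wpM2l i0 d3.
    have -> : C2 * g = delta^-1 * g +
        (ln (9 / 8))^-1 * ((c4 / delta + 2) * g) by rewrite /C2; ring.
    exact: lerD.
  have P1 : P0%:R <= (2 * C1 + l0^-1) * ((1 + Num.sqrt (kappa / n%:R)) * ln eps^-1).
    have a0 : 0 <= 2 / s * Lam by rewrite !mulr_ge0 ?invr_ge0 ?ltW.
    have : (Num.truncn (2 / s * Lam))%:R <= 2 / s * Lam by rewrite truncn_le.
    have e1 : 1 <= l0^-1 * ln eps^-1 by rewrite ler_pdivlMl// mulr1.
    have e2 : (2 * C1 + l0^-1) * ln eps^-1 * s^-1 <=
        (2 * C1 + l0^-1) * ln eps^-1 * (1 + Num.sqrt (kappa / n%:R)).
      apply: ler_wpM2l => //; rewrite ltW// mulr_gt0// addr_gt0 ?mulr_gt0// invr_gt0//.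
    have e3 : 1 <= l0^-1 * ln eps^-1 * s^-1.
      by rewrite -[1]mulr1; apply: ler_pM.
    rewrite /P0 -natr1 /Lam => e4; lra.
  rewrite natrM; apply: le_trans (ler_pM (ler0n _ _) (ler0n _ _) K1 P1) _.
  by rewrite le_eqVlt; apply/orP; left; apply/eqP; ring.
move=> P P0P TKP; rewrite /eps_optimal /dasvrg dexpect_bind.
have nt0 : (0 < nt)%N by rewrite subn_gt0.
have N0 : (0 < m * n)%N by rewrite muln_gt0 m0.
apply: dexpect_unif_le => [|a]; first exact: ltW.
rewrite dexpect_bind.
rewrite (@eq_dexpect _ _ _ _ (fun r : (T * K * P).-tuple 'I_(m * n) =>
    dexpect (diter P (outer_step T K eta sigma alpha F (part a))
      (pool_init nt r, (x0, x0))) (fun st => f st.2.1 - f xs))); last first.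
  by move=> r; rewrite dexpect_bind; apply: eq_dexpect => st; rewrite dexpect_ret.
rewrite (dasvrg_iid N0 T K P eta sigma F nt0 a x0 (fun x => f x - f xs) betaC).
have ss : s ^+ 2 = mu / (mu + sigma) := sqrt_ratio_sqr mu0 sigma0.
(* As [n >= 1], this value lies between 1/16 and 1/8. *)
have etaLE : eta * (L + sigma) = (1 + n%:R^-1) / 16.
  by rewrite etaE sigmaE; field; rewrite !gt_eqF.
have ni : n%:R^-1 <= 1 :> R by rewrite invf_le1.
have ni0 : 0 < n%:R^-1 :> R by rewrite invr_gt0.
apply: (le_trans (outer_loop N0 L0 mu0 sigma0 s0 ss (fun i => (hF i).1)
  (fun i => (hF i).2) fsc fmin _ _ _ (stages_rate mu0 sigma0 KE) P x0)).
- by rewrite etaLE; lra.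
- by rewrite etaLE; lra.
- by have := ceil_ge (96 * ((L + sigma) / (mu + sigma))); rewrite -TE.
have D0 : 0 <= f x0 - f xs by rewrite subr_ge0.
have D2 : 0 < 2 * Delta by rewrite mulr_gt0.
have dec : (1 - s / 2) ^+ P <= expR (- Lam).
  apply: decay; first by lra.
  have : 2 / s * Lam <= P%:R.
    apply: (@le_trans _ _ P0%:R); last by rewrite ler_nat.
    by apply: ltW; exact: truncnS_gt.
  move=> /(ler_wpM2l (ltW (divr_gt0 s0 (ltr0n _ 2)))).
  by rewrite (_ : s / 2 * (2 / s * Lam) = Lam)//; field; rewrite gt_eqF.
have p0 : 0 <= (1 - s / 2) ^+ P by rewrite exprn_ge0//; lra.
apply: (@le_trans _ _ (expR (- Lam) * (2 * Delta))).
  by apply: ler_pM => //; rewrite ?mulr_ge0 ?ler_pM2l.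
rewrite -ler_ln ?posrE ?mulr_gt0 ?expR_gt0// lnM ?posrE ?expR_gt0// expRK.
have : `|ln (2 * Delta)| <= `|ln (2 * Delta)| / l0 * ln eps^-1.
  by rewrite -mulrA ler_peMr// ler_pdivlMl// mulr1.
have := ler_norm (ln (2 * Delta)).
rewrite /Lam /C1 lnV ?posrE//; lra.
Qed.
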